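(* Assume the Lindelöf Hypothesis (i.e. $|\zeta(\tfrac12+it)|\ll_\varepsilon (1+|t|)^{\varepsilon}$ for every $\varepsilon>0$). Let $X=(x_n)_{n\ge1}$ be a sequence of positive real numbers such that there is a constant $c>0$ with $x_{n+1}-x_n\ge c$ for all $n$, and such that $x_n$ has polynomial growth: there is a constant $C$ with $x_n\ll n^{C}$. Suppose that for some $\beta$ and every $\varepsilon>0$, $$E^{*}(X,N)\ll N^{\beta+\varepsilon}.$$ Then for almost every $\alpha\in\mathbb{R}$, $$\delta_{\min}^{\alpha}(N)<\frac{1}{N^{4-\beta-o(1)}},$$ where the rate of decay of the $o(1)$ term depends on $\alpha$.
   Context: For $x\in\mathbb{R}$, $\|x\|=\min_{k\in\mathbb{Z}}|x-k|$. For $\alpha\in\mathbb{R}$, $\delta_{\min}^{\alpha}(N)=\min\{\|\alpha x_m-\alpha x_n\| : 1\le m,n\le N,\ m\ne n\}$. The additive energy is $E^{*}(X,N)=\#\{(n_1,n_2,n_3,n_4)\in[1,N]^4 : |x_{n_1}+x_{n_2}-x_{n_3}-x_{n_4}|<1\}$. The notation $\frac{1}{N^{\kappa-o(1)}}$ means $N^{-(\kappa-f_\alpha(N))}$ for some function $f_\alpha(N)\to0$ as $N\to\infty$, the inequality holding for all sufficiently large $N$. *)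

(* Defs.v *)
From HB Require Import structures.
From mathcomp Require Import all_boot all_order all_algebra.
From mathcomp Require Import all_classical all_reals all_analysis.
From mathcomp Require Import Rstruct Rstruct_topology.
Set Implicit Arguments. Unset Strict Implicit. Unset Printing Implicit Defensive.
Import Order.TTheory GRing.Theory Num.Theory.
Local Open Scope classical_set_scope.
Local Open Scope ring_scope.

Section Defs.
Variable R : realType.

Definition dist_int (x : R) : R := inf [set `|x - k%:~R| | k in [set: int]].

Definition delta_min (x : nat -> R) (alpha : R) (N : nat) : R :=
  inf [set dist_int (alpha * x mn.1 - alpha * x mn.2) |
        mn in [set mn : nat * nat | [/\ (1 <= mn.1 <= N)%N, (1 <= mn.2 <= N)%N & mn.1 != mn.2]]].

(** E*(X,N) = #{(n1,n2,n3,n4) in [1,N]^4 : |x_n1 + x_n2 - x_n3 - x_n4| < 1};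
    the ordinal i : 'I_N stands for the index i+1 in [1,N]. *)
Definition energy (x : nat -> R) (N : nat) : nat :=
  #|[set t : 'I_N * 'I_N * 'I_N * 'I_N |
      `|x t.1.1.1.+1 + x t.1.1.2.+1 - x t.1.2.+1 - x t.2.+1| < 1]|.

(** Dirichlet eta function on the critical line, s = 1/2 + i t:
    eta(s) = sum_{n>=1} (-1)^(n-1) n^(-s),  n^(-s) = n^(-1/2) (cos(t ln n) - i sin(t ln n)).
    The series converges for Re s > 0. *)
Definition eta_half_re (t : R) : R :=
  limn (fun M : nat => \sum_(0 <= k < M)
          (-1) ^+ k * (k.+1%:R) `^ (- 2^-1) * cos (t * ln (k.+1%:R))).
Definition eta_half_im (t : R) : R :=
  limn (fun M : nat => \sum_(0 <= k < M)
          - ((-1) ^+ k * (k.+1%:R) `^ (- 2^-1) * sin (t * ln (k.+1%:R)))).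

(** zeta(s) = eta(s) / (1 - 2^(1-s)), and for s = 1/2 + i t,
    1 - 2^(1-s) = (1 - sqrt 2 cos(t ln 2)) + i sqrt 2 sin(t ln 2) (never 0).
    zeta_half_abs t = |zeta(1/2 + i t)|, the modulus of that complex quotient. *)
Definition zeta_half_abs (t : R) : R :=
  Num.sqrt (eta_half_re t ^+ 2 + eta_half_im t ^+ 2) /
  Num.sqrt ((1 - Num.sqrt 2 * cos (t * ln 2)) ^+ 2 + (Num.sqrt 2 * sin (t * ln 2)) ^+ 2).

Definition Lindelof_hypothesis : Prop :=
  forall eps : R, 0 < eps -> exists K : R, forall t : R,
    zeta_half_abs t <= K * (1 + `|t|) `^ eps.

End Defs.

(* Main.v *)
Require Import Defs.
From HB Require Import structures.
From mathcomp Require Import all_boot all_order all_algebra.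
From mathcomp Require Import Rstruct Rstruct_topology.
From mathcomp Require Import all_classical all_reals all_analysis.
From mathcomp Require Import measurable_realfun.
From mathcomp Require Import ring lra zify.
Import Order.TTheory GRing.Theory Num.Theory.
Import numFieldNormedType.Exports.
Local Open Scope classical_set_scope.
Local Open Scope ring_scope.

(** Let [N = z ^ p] with [z = 2 ^ l], so that [z] plays the role of [N ^ eps].
    By Cauchy-Schwarz and the bound on the energy, some dyadic block [[Y, 2Y]]
    contains [M], at least [N ^ (4 - beta - O(eps))], differences [d] with distinct
    integer parts.  Writing [alpha = exp u], the distance from [alpha * d] to [n]
    is small when [u + ln d - ln n] is, so one counts pairs [(d, n)] weighted by
    [n ^ (-1/2) * ker (u + ln d - ln n)], where [ker x = cos (theta x / 2) ^ (2m)]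
    is a nonnegative trigonometric polynomial of width about [1 / T].
    Replacing [n] by [n / 2 ^ i] gives sums [S_i]; [S_i - S_(i-1)] is the same
    sum with the sign [(-1) ^ (n - 1)], because even [n] reproduce half of
    [S_(i-1)].  For [J] of size [O(log N)] the points [n / 2 ^ J] are so dense that
    [S_J] has its expected size for every [u], while [S_0] is negligible if no
    [alpha * d] is close to an integer.  On the other hand, the mean square of
    [S_i - S_(i-1)] is, by Parseval over a period of [ker], a weighted sum of
    [|sum_d d ^ (i t)| ^ 2 * |eta (1/2 + i t)| ^ 2] over the frequencies [t] of
    [ker]: the Lindelof hypothesis bounds the second factor by [N ^ eps], and the
    remaining sum collapses to [sum_(d, d') ker (ln d - ln d') = O(M)].
    Chebyshev and Borel-Cantelli along [N = 2 ^ (p l)] conclude. *)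

(** * Trigonometric and binomial estimates *)

Lemma normr_sin_le {R : realType} (y : R) : `|sin y| <= `|y|.
Proof.
wlog y0 : y / 0 < y => [hw|].
  have [y0|y0|->] := ltgtP y 0; last by rewrite sin0.
  - by rewrite -(normrN y) -(normrN (sin y)) -sinN hw ?oppr_gt0.
  - exact: hw.
have [c _] := @MVT R sin cos 0 y y0 (fun x _ => is_derive_sin x)
  (continuous_subspaceT (@continuous_sin R)).
rewrite sin0 !subr0 => ->; rewrite normrM ler_piMl//.
exact: cos_max.
Qed.

Lemma cos_ge_quadratic {R : realType} (y : R) : 1 - y ^+ 2 / 2 <= cos y.
Proof.
have {2}-> : y = y / 2 *+ 2 by rewrite -mulr_natr; field.
rewrite cos_mulr2n cos2sin2.
have : sin (y / 2) ^+ 2 <= (y / 2) ^+ 2.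
  by rewrite -(real_normK (num_real (sin _))) -(real_normK (num_real (y / 2))) lerXn2r ?nnegrE// normr_sin_le.
rewrite exprMn -[X in _ -> _ <= X - 1]mulr_natr; lra.
Qed.

(** For positive [y] the mean value theorem gives [sin y = y * cos c] with [0 < c < y <= 1], and
    [cos c >= 1 / 2] there. *)
Lemma sqr_cos_le {R : realType} (y : R) : `|y| <= 1 -> cos y ^+ 2 <= 1 - y ^+ 2 / 4.
Proof.
wlog y0 : y / 0 < y => [hw|].
  have [y0|y0|->] := ltgtP y 0; last by rewrite cos0; lra.
  - by move=> h; have := hw (- y); rewrite oppr_gt0 normrN cosN sqrrN; exact.
  - exact: hw.
rewrite gtr0_norm// => y1; rewrite cos2sin2.
have [c] := @MVT R sin cos 0 y y0 (fun x _ => is_derive_sin x)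
  (continuous_subspaceT (@continuous_sin R)).
rewrite in_itv/= sin0 !subr0 => /andP[c0 cy] ->.
have hc := cos_ge_quadratic c.
have c1 : c <= 1 by lra.
have c2 : c ^+ 2 <= 1 by rewrite exprn_ile1// ltW.
have : (1/2) ^+ 2 <= cos c ^+ 2 by rewrite lerXn2r ?nnegrE//; lra.
rewrite exprMn => h.
have := ler_wpM2r (sqr_ge0 y) h; lra.
Qed.

Lemma one_sub_exp_le {R : realType} (w : R) (m : nat) :
  w <= 1 -> (1 - w) ^+ m <= expR (- (m%:R * w)).
Proof.
move=> w1; rewrite -mulrN expRM_natl lerXn2r ?nnegrE ?expR_ge0//; first lra.
by have := expR_ge1Dx (- w); lra.
Qed.

Lemma expRN_le_inv {R : realType} (x : R) : 0 < x -> expR (- x) <= x^-1.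
Proof.
move=> x0; rewrite expRN lef_pV2 ?posrE ?expR_gt0//.
by have := expR_ge1Dx x; lra.
Qed.

(* Joint induction: both sums satisfy s_(r+1) = 2 cos y * s_r. *)
Lemma cos_exp_binomial {R : realType} (r : nat) (y : R) :
  \sum_(0 <= j < r.+1) 'C(r, j)%:R * cos ((r%:R - (j.*2)%:R) * y) = (2 * cos y) ^+ r /\
  \sum_(0 <= j < r.+1) 'C(r, j)%:R * sin ((r%:R - (j.*2)%:R) * y) = 0.
Proof.
have pascal r' (g : R -> R) :
    \sum_(0 <= j < r'.+2) 'C(r'.+1, j)%:R * g ((r'.+1)%:R - (j.*2)%:R) =
    \sum_(0 <= j < r'.+1) 'C(r', j)%:R *
      (g ((r'%:R - (j.*2)%:R) + 1) + g ((r'%:R - (j.*2)%:R) - 1)).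
  rewrite big_nat_recl// bin0 double0 subr0.
  under eq_bigr => j _ do rewrite binS natrD mulrDl.
  rewrite big_split/= addrA.
  under [RHS]eq_bigr => j _ do rewrite mulrDr.
  rewrite big_split/=; congr (_ + _).
  - rewrite [X in _ + X]big_nat_recr//= bin_small// mul0r addr0.
    rewrite [RHS]big_nat_recl// bin0 double0 subr0 natr1; congr (_ + _).
    apply: eq_bigr => j _; congr (_ * g _).
    by rewrite -(natr1 r'); ring.
  - apply: eq_bigr => j _; congr (_ * g _).
    by rewrite doubleS -(natr1 r') -(natr1 j.*2.+1) -(natr1 j.*2); ring.
elim: r => [|r [IHc IHs]].
  by rewrite !big_nat1 bin0 double0 subrr mul0r cos0 sin0 expr0 !mul1r.
split.
- rewrite (pascal r (fun s => cos (s * y))) exprS -IHc mulr_sumr.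
  apply: eq_bigr => j _.
  move: (r%:R - _) => x; rewrite mulrDl mulrBl !mul1r cosD cosB; ring.
- rewrite (pascal r (fun s => sin (s * y))).
  transitivity (2 * cos y * 0 : R); last by rewrite mulr0.
  rewrite -[in RHS]IHs mulr_sumr.
  apply: eq_bigr => j _.
  move: (r%:R - _) => x; rewrite mulrDl mulrBl !mul1r sinD sinB; ring.
Qed.

Lemma bin_le_central (m j : nat) : ('C(m.*2, j) <= 'C(m.*2, m))%N.
Proof.
have step n i : (i.*2 < n)%N -> ('C(n, i) <= 'C(n, i.+1))%N.
  move=> h; have := mul_bin_left n i => e.
  rewrite -(leq_pmul2l (ltn0Sn i)) e leq_mul2r; apply/orP; right; lia.
have low i : (i <= m)%N -> ('C(m.*2, i) <= 'C(m.*2, m))%N.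
  move=> im; rewrite -(subKn im); move: (m - i)%N (leq_subr i m) => k.
  elim: k => [|k IH] km; first by rewrite subn0.
  apply: leq_trans (IH (ltnW km)).
  rewrite (_ : (m - k)%N = (m - k.+1).+1); last lia.
  apply: step; lia.
have [jm|jm] := leqP j m; first exact: low.
have [j2|j2] := leqP j m.*2; last by rewrite bin_small.
by rewrite -bin_sub//; apply: low; lia.
Qed.

(** Induction through [(m + 1) C(2m + 2, m + 1) = 2 (2m + 1) C(2m, m)]; with [q = m + 1] the step
    reduces to [(2q - 1)(2q + 1) <= 4 q ^ 2]. *)
Lemma central_bin_bound {R : realType} (m : nat) :
  ('C(m.*2, m)%:R : R) ^+ 2 * (m.*2.+1)%:R <= (4 ^+ m) ^+ 2.
Proof.
elim: m => [|m IH]; first by rewrite double0 bin0 expr0 !expr1n mulr1.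
have e : (m.+1)%:R * ('C(m.+1.*2, m.+1)%:R : R) = 2 * (m.*2.+1)%:R * 'C(m.*2, m)%:R.
  rewrite -!natrM; congr (_%:R).
  rewrite doubleS.
  have h1 := mul_bin_diag m.*2.+1 m.
  have h2 := mul_bin_diag m.*2 m.
  have h3 : 'C(m.*2.+1, m.+1) = 'C(m.*2.+1, m).
    by rewrite -(@bin_sub _ m); [congr ('C(_, _)); lia|lia].
  rewrite binS h3 -h3.
  have h4 : (m.+1 * 'C(m.*2.+1, m.+1) = m.*2.+1 * 'C(m.*2, m))%N by rewrite -mul_bin_diag.
  by rewrite mulnDr h4; lia.
set b := 'C(m.+1.*2, m.+1)%:R in e *; set a := 'C(m.*2, m)%:R in IH e *.
have m1 : 0 < (m.+1)%:R :> R by rewrite ltr0n.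
rewrite -(ler_pM2l (exprn_gt0 2 m1)) mulrA -exprMn e.
rewrite [4 ^+ m.+1]exprSr [X in _ <= _ * X]exprMn.
have := ler_wpM2l (ltW (exprn_gt0 2 m1)) IH.
have d1 : (m.*2.+1)%:R = 2 * m.+1%:R - 1 :> R by rewrite -muln2 -!natr1 natrM; ring.
have d2 : (m.+1.*2.+1)%:R = 2 * m.+1%:R + 1 :> R by rewrite -muln2 -!natr1 natrM -natr1; ring.
have q1 : 1 <= m.+1%:R :> R by rewrite ler1n.
rewrite d2; rewrite d1 in IH *; move: (m.+1%:R : R) m1 q1 IH => q q0 q1 IH IH'.
have h : (2 * q - 1) * (2 * q + 1) <= 4 * q ^+ 2 by lra.
have p : 0 <= a ^+ 2 * (2 * q - 1) * 4 by rewrite !mulr_ge0 ?sqr_ge0//; lra.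
have := ler_wpM2l p h.
have -> : (2 * (2 * q - 1) * a) ^+ 2 * (2 * q + 1) =
          a ^+ 2 * (2 * q - 1) * 4 * ((2 * q - 1) * (2 * q + 1)) by ring.
move=> /le_trans; apply.
have -> : a ^+ 2 * (2 * q - 1) * 4 * (4 * q ^+ 2) = 16 * (q ^+ 2 * (a ^+ 2 * (2 * q - 1))) by ring.
have -> : q ^+ 2 * ((4 ^+ m) ^+ 2 * 4 ^+ 2) = 16 * (q ^+ 2 * (4 ^+ m) ^+ 2) by ring.
lra.
Qed.

(** Flatness of the spectrum of the kernel: in the mean square, one of the two factors [wt] is
    traded for [m ^ (-1/2)], a gain of order [theta / T]. *)
Lemma bin_weight_le {R : realType} (m j : nat) : (0 < m)%N ->
  'C(m.*2, j)%:R / 4 ^+ m <= (Num.sqrt m%:R)^-1 :> R.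
Proof.
move=> m0; have m0' : 0 < m%:R :> R by rewrite ltr0n.
have p4 : 0 < 4 ^+ m :> R by rewrite exprn_gt0.
apply: (@le_trans _ _ ('C(m.*2, m)%:R / 4 ^+ m)).
  by rewrite ler_pM2r ?invr_gt0// ler_nat bin_le_central.
rewrite ler_pdivrMr// mulrC ler_pdivlMr ?sqrtr_gt0//.
rewrite -(@ler_pXn2r _ 2)// ?nnegrE ?mulr_ge0 ?sqrtr_ge0 ?exprn_ge0//.
rewrite exprMn sqr_sqrtr ?ler0n//.
apply: le_trans (@central_bin_bound R m).
by rewrite ler_wpM2l ?sqr_ge0// ler_nat; lia.
Qed.

(** * Mean values over a period *)

(** The mean is encoded by an antiderivative whose increment over every window of length [L] is
    [L * c]. Linearity and trigonometric means then need no integral; integration enters only in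
    [has_mean_markov]. *)
Definition has_mean {R : realType} (L : R) (f : R -> R) (c : R) : Prop :=
  exists2 Phi : R -> R, (forall u : R, is_derive u 1 Phi (f u)) &
    forall u : R, Phi (u + L) - Phi u = L * c.

Lemma has_mean_cst {R : realType} (L c : R) : has_mean L (fun=> c) c.
Proof.
exists (fun u => u * c) => [u|u]; last by ring.
by apply: is_derive_eq; rewrite scaler0 add0r /GRing.scale/= mulr1.
Qed.

Lemma has_meanD {R : realType} (L : R) (f g : R -> R) (c d : R) :
  has_mean L f c -> has_mean L g d -> has_mean L (fun u => f u + g u) (c + d).
Proof.
move=> [F dF mF] [G dG mG]; exists (fun u => F u + G u) => [u|u].
  exact: is_deriveD.
by rewrite mulrDr -(mF u) -(mG u); ring.
Qed.

Lemma has_meanZ {R : realType} (L a : R) (f : R -> R) (c : R) :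
  has_mean L f c -> has_mean L (fun u => a * f u) (a * c).
Proof.
move=> [F dF mF]; exists (fun u => a * F u) => [u|u].
  exact: is_deriveZ.
by rewrite mulrCA -(mF u); ring.
Qed.

Lemma has_mean_sum {R : realType} (L : R) (n : nat) (f : nat -> R -> R) (c : nat -> R) :
  (forall j, (j < n)%N -> has_mean L (f j) (c j)) ->
  has_mean L (fun u => \sum_(0 <= j < n) f j u) (\sum_(0 <= j < n) c j).
Proof.
elim: n => [|n IH] h.
  rewrite big_geq//; under eq_fun do rewrite big_geq//.
  exact: has_mean_cst.
rewrite big_nat_recr//=; under eq_fun do rewrite big_nat_recr//=.
by apply: has_meanD; [apply: IH => j jn; apply: h; lia|exact: h].
Qed.

Lemma has_mean_cos {R : realType} (theta phi : R) (n : nat) : 0 < theta -> (0 < n)%N ->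
  has_mean (pi *+ 2 / theta) (fun u => cos (n%:R * theta * u + phi)) 0.
Proof.
move=> t0 n0; have nt0 : n%:R * theta != 0.
  by rewrite mulf_neq0 ?gt_eqF// ltr0n.
exists (fun u => (n%:R * theta)^-1 * sin (n%:R * theta * u + phi)) => [u|u].
  have -> : cos (n%:R * theta * u + phi) =
    (n%:R * theta)^-1 * (cos (n%:R * theta * u + phi) * (n%:R * theta)).
    by field; rewrite gt_eqF// pnatr_eq0 -lt0n n0.
  apply: is_deriveZ; apply: is_derive1_comp.
  apply: is_derive_eq.
  by rewrite addr0 /GRing.scale/= mulr1.
rewrite mulr0 -mulrBr; apply/eqP; rewrite mulf_eq0; apply/orP; right; apply/eqP.
have -> : n%:R * theta * (u + pi *+ 2 / theta) + phi =
   n%:R * theta * u + phi + pi *+ 2 *+ n.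
  by rewrite -[in RHS](mulr_natl (pi *+ 2) n); field; rewrite gt_eqF.
by rewrite (periodicn (@sinD2pi R)) subrr.
Qed.

Lemma has_mean_cosB {R : realType} (theta phi : R) (i j : nat) : 0 < theta -> i <> j ->
  has_mean (pi *+ 2 / theta) (fun u => cos ((i%:R - j%:R) * theta * u + phi)) 0.
Proof.
move=> t0.
have [ij _|ji _|->//] := ltngtP i j.
- have -> : (fun u => cos ((i%:R - j%:R) * theta * u + phi)) =
     (fun u => cos ((j - i)%:R * theta * u - phi)).
    by apply/funext => u; rewrite natrB ?(ltnW ij)// -cosN; congr cos; ring.
  by apply: has_mean_cos; rewrite ?subn_gt0.
- rewrite -natrB ?(ltnW ji)//.
  by apply: has_mean_cos; rewrite ?subn_gt0.
Qed.

(* The vanishing conjugate sum [G] is added to [F ^+ 2] so that only the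
   differences of frequencies survive. *)
Lemma parseval {R : realType} (theta a : R) (n : nat) (A B : nat -> R) : 0 < theta ->
  (forall u : R, \sum_(0 <= j < n) (A j * sin ((a - j%:R) * theta * u) -
                                B j * cos ((a - j%:R) * theta * u)) = 0) ->
  has_mean (pi *+ 2 / theta)
    (fun u => (\sum_(0 <= j < n) (A j * cos ((a - j%:R) * theta * u) +
                                  B j * sin ((a - j%:R) * theta * u))) ^+ 2)
    (\sum_(0 <= j < n) (A j ^+ 2 + B j ^+ 2)).
Proof.
move=> t0 G0.
pose f j u := (a - j%:R) * theta * u.
(* In [F ^+ 2 + G ^+ 2] each pair depends on [k - j] alone. Sines are written as cosines shifted by
   [pi / 2], so that [has_mean_cosB] handles both kinds of terms. *)
have -> : (fun u => (\sum_(0 <= j < n) (A j * cos ((a - j%:R) * theta * u) +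
                                  B j * sin ((a - j%:R) * theta * u))) ^+ 2) =
  (fun u => \sum_(0 <= j < n) \sum_(0 <= k < n)
     ((A j * A k + B j * B k) * cos ((k%:R - j%:R) * theta * u + 0) +
      (A j * B k - B j * A k) * cos ((k%:R - j%:R) * theta * u + pi / 2))).
  apply/funext => u.
  set F := (X in X ^+ 2 = _); have := G0 u; set G := (X in X = 0 -> _) => Gu.
  have -> : F ^+ 2 = F * F + G * G by rewrite Gu; ring.
  rewrite !big_distrlr/= -big_split/=.
  apply: eq_bigr => j _; rewrite -big_split/=; apply: eq_bigr => k _.
  rewrite cosDpihalf addr0.
  have -> : (k%:R - j%:R) * theta * u = f j u - f k u by rewrite /f; ring.
  by rewrite cosB sinB /f; ring.
apply: has_mean_sum => j jn.
have -> : A j ^+ 2 + B j ^+ 2 = \sum_(0 <= k < n) (if k == j then A j ^+ 2 + B j ^+ 2 else 0).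
  by rewrite -big_mkcond/= big_nat1_eq jn.
apply: has_mean_sum => k kn.
have [->|/eqP kj] := eqVneq k j.
  rewrite [X in has_mean _ _ X](_ : _ =
    (A j * A j + B j * B j) * 1 + (A j * B j - B j * A j) * 0); last by ring.
  apply: has_meanD; apply: has_meanZ.
  - under eq_fun do rewrite subrr !mul0r add0r cos0.
    exact: has_mean_cst.
  - under eq_fun do rewrite subrr !mul0r add0r cos_pihalf.
    exact: has_mean_cst.
rewrite [X in has_mean _ _ X](_ : _ =
  (A j * A k + B j * B k) * 0 + (A j * B k - B j * A k) * 0); last by ring.
by apply: has_meanD; apply: has_meanZ; apply: has_mean_cosB.
Qed.

(** Markov's inequality after the substitution [al = exp u]: the density [f (ln al) / al] has
    antiderivative [Phi \o ln], and it is at least [lam / A] where [al <= A] and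
    [f (ln al) >= lam]. *)
Lemma has_mean_markov {R : realType} (L A c lam : R) (f : R -> R) :
  0 < L -> 1 <= A -> 2 * ln A <= L -> 0 < lam ->
  continuous f -> (forall u, 0 <= f u) -> has_mean L f c ->
  exists E : set R, [/\ measurable E,
    (lebesgue_measure E <= (A * L * c / lam)%:E)%E &
    forall al, A^-1 <= al <= A -> lam <= f (ln al) -> E al].
Proof.
move=> L0 A1 LA lam0 cf f0 [Phi dPhi mPhi].
have A0 : 0 < A by lra.
have V0 : 0 < A^-1 by rewrite invr_gt0.
(* [[A^-1, b]] has logarithmic length exactly [L], hence integral [L * c]; the hypothesis
   [2 * ln A <= L] makes it contain [[A^-1, A]]. *)
pose b := expR L / A.
have expA : A * A <= expR L.
  by rewrite -[A * A]expr2 -[A]lnK ?posrE// -expRM_natl ler_expR.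
have bA : A <= b by rewrite /b ler_pdivlMr.
have Vb : A^-1 < b.
  rewrite /b -[ltLHS]mul1r ltr_pM2r// -expR0 ltr_expR//.
pose g al := f (ln al) / al.
have cg (x : R) : 0 < x -> {for x, continuous g}.
  move=> x0; apply: cvgM; last by apply: cvgV => //; rewrite gt_eqF.
  by apply: continuous_comp; [exact: continuous_ln|exact: cf].
have dg (x : R) : 0 < x -> is_derive x 1 (Phi \o (@ln R)) (g x).
  by move=> x0; apply: is_derive1_comp; exact: is_derive1_ln.
have pos x : x \in `[A^-1, b] -> 0 < x.
  by rewrite in_itv/= => /andP[h _]; exact: lt_le_trans h.
have cwg : {within `[A^-1, b], continuous g}.
  by apply: continuous_in_subspaceT => x; rewrite inE => /pos; exact: cg.
have FTC : (\int[lebesgue_measure]_(x in `[A^-1%R, b]) (g x)%:E = (L * c)%:E)%E.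
  rewrite (@continuous_FTC2 _ g (Phi \o (@ln R)))//; last 2 first.
  - have dd x : 0 < x -> derivable (Phi \o (@ln R)) x 1.
      by move=> /dg [].
    split.
    + by move=> x; rewrite in_itv/= => /andP[h _]; apply: dd; exact: lt_trans h.
    + apply: cvg_at_right_filter; apply/differentiable_continuous/derivable1_diffP; exact: dd.
    + apply: cvg_at_left_filter; apply/differentiable_continuous/derivable1_diffP; apply: dd.
      exact: lt_trans Vb.
  - move=> x; rewrite in_itv/= => /andP[h _]; rewrite derive1E.
    by have [_ ->] := dg x (lt_trans V0 h).
  rewrite -EFinB/= -(mPhi (- ln A)) lnV ?posrE//.
  by rewrite /b ln_div ?posrE ?expR_gt0// expRK [L - _]addrC.
have mg' : measurable_fun `[A^-1, b]%classic g.
  exact: subspace_continuous_measurable_fun.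
have mg := (measurable_EFinP _ _).2 mg'.
pose E := `[A^-1, b]%classic `&` [set x : R | ((lam / A)%:E <= `|(EFin \o g) x|)%E].
have lA : 0 < lam / A by rewrite divr_gt0.
exists E; split.
- by apply: emeasurable_fun_c_infty => //; exact: measurableT_comp.
- have /= := @le_integral_comp_abse _ _ R lebesgue_measure `[A^-1, b]%classic
    (measurable_itv _) (EFin \o g) (lam / A) id (@measurable_id _ _ _) (fun _ => id)
    (fun _ _ _ _ => id) mg lA.
  have -> : (\int[lebesgue_measure]_(x in `[A^-1%R, b]) `|(g x)%:E| = (L * c)%:E)%E.
    rewrite -FTC; apply: eq_integral => x; rewrite inE/= => /pos x0.
    by rewrite ger0_norm// divr_ge0// ltW.
  rewrite muleC -lee_pdivlMr// => /le_trans; apply.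
  rewrite -EFinM lee_fin invf_div le_eqVlt; apply/orP; left; apply/eqP.
  by field; rewrite gt_eqF.
- move=> x /andP[x1 x2] h; split=> /=.
    by rewrite in_itv/= x1 (le_trans x2).
  have x0 : 0 < x by exact: lt_le_trans x1.
  rewrite lee_fin ger0_norm; last by rewrite divr_ge0 ?(ltW x0).
  by rewrite /g ler_pM ?lef_pV2 ?posrE ?invr_ge0 ?(ltW A0) ?(ltW lam0).
Qed.

(** * Partial sums of the eta function *)

(** Twice the alternating sum is, up to the boundary terms at [m] and [n], the sum of
    [(-1) ^ k * (f k - f k.+1)], which the decrements of [g] dominate and telescope. *)
Lemma alternating_sum_le {R : realType} (f g : nat -> R) (m n : nat) : (m <= n)%N ->
  (forall k, `|f k - f k.+1| <= g k - g k.+1) -> (forall k, `|f k| <= g k) ->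
  `|\sum_(m <= k < n) (-1) ^+ k * f k| <= g m.
Proof.
move=> mn df fg.
have nsign k : `|(-1) ^+ k| = 1 :> R by rewrite normrX normrN1 expr1n.
have h : forall n, (m <= n)%N ->
    `|2 * \sum_(m <= k < n) (-1) ^+ k * f k - (-1) ^+ m * f m + (-1) ^+ n * f n| <= g m - g n.
  elim=> [|n' IH].
    rewrite leqn0 => /eqP->; rewrite big_geq// mulr0 add0r addNr normr0 subrr//.
  rewrite leq_eqVlt => /predU1P[<-|].
    by rewrite big_geq// mulr0 add0r addNr normr0 subrr.
  rewrite ltnS => mn'; rewrite big_nat_recr//=.
  apply: (@le_trans _ _ (g m - g n' + (g n' - g n'.+1))); last by lra.
  have dn : `|(-1) ^+ n' * (f n' - f n'.+1)| <= g n' - g n'.+1.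
    by rewrite normrM nsign mul1r.
  apply: le_trans (lerD (IH mn') dn).
  apply: le_trans (ler_normD _ _); rewrite le_eqVlt; apply/orP; left; apply/eqP.
  by congr `|_|; rewrite exprS; ring.
have := h n mn; set S := \sum_(_ <= _ < _) _.
rewrite ler_norml => /andP[h1 h2].
have sgn k : `|(-1) ^+ k * f k| <= g k.
  by rewrite normrM nsign mul1r.
have := sgn m; have := sgn n; rewrite !ler_norml => /andP[a1 a2] /andP[b1 b2].
apply/andP; split; lra.
Qed.

Section EtaTail.
Context {R : realType} (c : R -> R).
Hypothesis c1 : forall x, `|c x| <= 1.
Hypothesis c_lip : forall x y, `|c x - c y| <= `|x - y|.

Let r (k : nat) : R := (k.+1%:R) `^ (- 2^-1).

Let rE k : r k = (Num.sqrt k.+1%:R)^-1.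
Proof. by rewrite /r powRN powR12_sqrt ?ler0n. Qed.

Let r_gt0 k : 0 < r k.
Proof. by rewrite rE invr_gt0 sqrtr_gt0 ltr0n. Qed.

(** Between consecutive indices [c (t * ln k.+1)] moves by at most [|t| / k.+1]; this inequality
    pays for that variation with the decrease of [r], whence the factor [1 + 3 * |t|] below. *)
Let r_diff k : r k.+1 / k.+1%:R <= 3 * (r k - r k.+1).
Proof.
rewrite !rE; set p := Num.sqrt k.+1%:R; set q := Num.sqrt k.+2%:R.
have p0 : 0 < p by rewrite sqrtr_gt0 ltr0n.
have q0 : 0 < q by rewrite sqrtr_gt0 ltr0n.
have pp : p ^+ 2 = k.+1%:R by rewrite sqr_sqrtr ?ler0n.
have qq : q ^+ 2 = p ^+ 2 + 1 by rewrite pp sqr_sqrtr ?ler0n// natr1.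
have p1 : 1 <= p ^+ 2 by rewrite pp ler1n.
have q2p : q <= 2 * p.
  rewrite -(@ler_pXn2r _ 2)// ?nnegrE ?mulr_ge0 ?ltW// exprMn qq; lra.
have pq : p <= q by rewrite -(@ler_pXn2r _ 2)// ?nnegrE ?ltW// qq; lra.
rewrite -pp -(ler_pM2r (mulr_gt0 (exprn_gt0 2 p0) q0)).
have -> : q^-1 / p ^+ 2 * (p ^+ 2 * q) = 1 by field; rewrite !gt_eqF.
have -> : 3 * (p^-1 - q^-1) * (p ^+ 2 * q) = 3 * p * (q - p) by field; rewrite !gt_eqF.
have e : (q - p) * (q + p) = 1 by rewrite -subr_sqr qq; ring.
rewrite -{1}e; have : 0 <= q - p by rewrite subr_ge0.
move=> d0; rewrite [leRHS]mulrC ler_wpM2l//; lra.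
Qed.

Let f (t : R) (k : nat) : R := r k * c (t * ln k.+1%:R).

Let f_diff t k : `|f t k - f t k.+1| <= (1 + 3 * `|t|) * r k - (1 + 3 * `|t|) * r k.+1.
Proof.
have rk := r_diff k; have r0 := r_gt0 k.+1.
have rr : r k.+1 <= r k.
  have h : 0 <= r k.+1 / k.+1%:R by rewrite divr_ge0// ltW.
  have := le_trans h rk; lra.
have -> : f t k - f t k.+1 = (r k - r k.+1) * c (t * ln k.+1%:R) +
   r k.+1 * (c (t * ln k.+1%:R) - c (t * ln k.+2%:R)) by rewrite /f; ring.
apply: le_trans (ler_normD _ _) _; rewrite !normrM.
have h1 : `|r k - r k.+1| * `|c (t * ln k.+1%:R)| <= r k - r k.+1.
  rewrite ger0_norm ?subr_ge0// ler_piMr// subr_ge0//.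
have lnd : `|ln k.+1%:R - ln k.+2%:R| <= (k.+1%:R)^-1 :> R.
  rewrite distrC -ln_div ?posrE ?ltr0n//.
  have -> : k.+2%:R / k.+1%:R = 1 + (k.+1%:R)^-1 :> R.
    by rewrite -natr1 mulrDl divff ?mul1r// pnatr_eq0.
  have i0 : 0 < (k.+1%:R)^-1 :> R by rewrite invr_gt0 ltr0n.
  rewrite ger0_norm; last by rewrite ln_ge0// lerDl ltW.
  by apply: le_ln1Dx; rewrite (lt_trans _ i0)// ltrN10.
have h2 : `|r k.+1| * `|c (t * ln k.+1%:R) - c (t * ln k.+2%:R)| <=
    `|t| * (3 * (r k - r k.+1)).
  rewrite (gtr0_norm r0).
  apply: (@le_trans _ _ (r k.+1 * (`|t| * (k.+1%:R)^-1))).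
    rewrite ler_pM2l//; apply: le_trans (c_lip _ _) _.
    by rewrite -mulrBr normrM ler_wpM2l.
  by rewrite mulrCA ler_wpM2l.
apply: le_trans (lerD h1 h2) _; lra.
Qed.

Let f_le t k : `|f t k| <= (1 + 3 * `|t|) * r k.
Proof.
rewrite normrM (gtr0_norm (r_gt0 k)) mulrC ler_pM2r//.
by have := c1 (t * ln k.+1%:R); have := normr_ge0 t; lra.
Qed.

(** Applied with [c] equal to [cos] and [sin]: about [t ^ 2] terms of the series bring each
    component of eta within 1. *)
Lemma eta_tail (t : R) (M : nat) :
  `|limn (fun M : nat => \sum_(0 <= k < M)
          (-1) ^+ k * (k.+1%:R) `^ (- 2^-1) * c (t * ln (k.+1%:R))) -
    \sum_(0 <= k < M) (-1) ^+ k * (k.+1%:R) `^ (- 2^-1) * c (t * ln (k.+1%:R))|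
    <= (1 + 3 * `|t|) / Num.sqrt M.+1%:R /\
  cvgn (fun M : nat => \sum_(0 <= k < M)
          (-1) ^+ k * (k.+1%:R) `^ (- 2^-1) * c (t * ln (k.+1%:R))).
Proof.
set s := fun M : nat => _.
pose C := 1 + 3 * `|t|.
have C0 : 0 < C by have := normr_ge0 t; rewrite /C; lra.
have d (m n : nat) : (m <= n)%N -> `|s n - s m| <= C * r m.
  move=> mn; rewrite /s (big_cat_nat _ mn)//= addrAC subrr add0r.
  under eq_bigr do rewrite -mulrA.
  exact: (alternating_sum_le (f t) (fun k => C * r k)).
have cv : cvgn s.
  have -> : s = series (fun k => (-1) ^+ k * (k.+1%:R) `^ (- 2^-1) * c (t * ln (k.+1%:R))) by [].
  apply/cauchy_cvgP/cauchy_seriesP => e e0.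
  have [N hN] : exists N : nat, (C / e) ^+ 2 < N%:R.
    by exists (Num.bound ((C / e) ^+ 2)); have := archi_boundP (sqr_ge0 (C / e)).
  have small m : (N <= m)%N -> C * r m < e.
    move=> Nm; rewrite rE ltr_pdivrMr ?sqrtr_gt0 ?ltr0n// mulrC -ltr_pdivrMr//.
    rewrite -(@ltr_pXn2r _ 2)// ?nnegrE ?sqrtr_ge0 ?divr_ge0 ?ltW//.
    rewrite sqr_sqrtr ?ler0n//; apply: lt_le_trans hN _.
    by rewrite ler_nat; lia.
  exists ([set n | (N <= n)%N], [set n | (N <= n)%N]); first by split; exists N.
  move=> [m n] [/= Nm Nn].
  have [mn|nm] := leqP m n; last by rewrite big_geq ?normr0// ltnW.
  under eq_bigr do rewrite -mulrA.
  by apply: le_lt_trans (small _ Nm); exact: (alternating_sum_le (f t) (fun k => C * r k)).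
split=> //.
rewrite -rE -/C.
have : (fun n => `|s n - s M|) @ \oo --> `|limn s - s M|.
  by apply: cvg_norm; apply: cvgB => //; exact: cvg_cst.
move=> h; rewrite -(cvg_lim _ h)//.
apply: limr_le; first by apply/cvg_ex; eexists; exact: h.
by exists M => // n /= Mn; exact: d.
Qed.

End EtaTail.

Lemma cos_lipschitz {R : realType} (x y : R) : `|cos x - cos y| <= `|x - y|.
Proof.
wlog xy : x y / y <= x => [hw|].
  by have [/hw//|/ltW/hw] := leP y x; rewrite distrC [leRHS]distrC.
have [z _ ->] := @MVT_segment R cos (fun x => - sin x) y x xy (fun x _ => is_derive_cos x)
  (continuous_subspaceT (@continuous_cos R)).
by rewrite normrM normrN ler_piMl// sin_max.
Qed.

Lemma sin_lipschitz {R : realType} (x y : R) : `|sin x - sin y| <= `|x - y|.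
Proof. by rewrite -!cosBpihalf (le_trans (cos_lipschitz _ _))// opprB addrA subrK. Qed.

Definition eta_cos {R : realType} (M : nat) (t : R) : R :=
  \sum_(0 <= k < M) (-1) ^+ k * (k.+1%:R) `^ (- 2^-1) * cos (t * ln (k.+1%:R)).
(** The sign is opposite to that of [eta_half_im]; the estimates involve only the square. *)
Definition eta_sin {R : realType} (M : nat) (t : R) : R :=
  \sum_(0 <= k < M) (-1) ^+ k * (k.+1%:R) `^ (- 2^-1) * sin (t * ln (k.+1%:R)).

Lemma eta_half_le {R : realType} (K eps t : R) :
  zeta_half_abs t <= K * (1 + `|t|) `^ eps ->
  eta_half_re t ^+ 2 + eta_half_im t ^+ 2 <= 9 * (K * (1 + `|t|) `^ eps) ^+ 2.
Proof.
set B := K * _; rewrite /zeta_half_abs.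
set e := _ + eta_half_im t ^+ 2; set D := (X in _ / Num.sqrt X).
(* [D] is the squared modulus of [1 - 2 ^ (1 - s)]. It lies between [(sqrt 2 - 1) ^ 2] and
   [(sqrt 2 + 1) ^ 2], which is below 9. *)
have D0 : 0 < D <= 9.
  have -> : D = 3 - 2 * Num.sqrt 2 * cos (t * ln 2).
    have s2 : Num.sqrt 2 ^+ 2 = 2 :> R by rewrite sqr_sqrtr.
    have := sin2cos2 (t * ln 2); rewrite /D.
    move: (Num.sqrt 2) s2 (cos _) (sin _) => s s2 x y y2.
    transitivity (1 - 2 * s * x + s ^+ 2 * (x ^+ 2 + y ^+ 2)); first by ring.
    by rewrite y2 s2; ring.
  have s0 : 0 <= Num.sqrt 2 :> R by exact: sqrtr_ge0.
  have s1 : Num.sqrt 2 ^+ 2 = 2 :> R by rewrite sqr_sqrtr.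
  have := cos_le1 (t * ln 2); have := cos_geN1 (t * ln 2).
  move: (Num.sqrt 2) (cos _) s0 s1 => s x s0 s1 x1 x2.
  have s15 : s < 3 / 2.
    by rewrite -(@ltr_pXn2r _ 2)// ?nnegrE//; lra.
  by apply/andP; split; nra.
case/andP: D0 => D0 D9.
have e0 : 0 <= e by rewrite addr_ge0 ?sqr_ge0.
rewrite ler_pdivrMr ?sqrtr_gt0// => h.
have : Num.sqrt e ^+ 2 <= (B * Num.sqrt D) ^+ 2.
  by rewrite lerXn2r ?nnegrE ?sqrtr_ge0// (le_trans (sqrtr_ge0 e)).
rewrite exprMn !sqr_sqrtr// ?(ltW D0)// => /le_trans; apply.
by rewrite mulrC ler_wpM2r ?sqr_ge0.
Qed.

Lemma eta_partial_le {R : realType} (t Q : R) (M : nat) :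
  `|t| <= Q -> (1 + 3 * Q) ^+ 2 <= M.+1%:R ->
  eta_cos M t ^+ 2 + eta_sin M t ^+ 2 <=
    2 * (eta_half_re t ^+ 2 + eta_half_im t ^+ 2) + 4.
Proof.
move=> tQ MQ.
have small : (1 + 3 * `|t|) / Num.sqrt M.+1%:R <= 1.
  rewrite ler_pdivrMr ?sqrtr_gt0 ?ltr0n// mul1r.
  have t0 := normr_ge0 t.
  have u0 : 0 <= 1 + 3 * `|t| by lra.
  rewrite -(@ler_pXn2r _ 2)// ?nnegrE ?sqrtr_ge0//.
  rewrite sqr_sqrtr ?ler0n//; apply: le_trans MQ.
  by rewrite lerXn2r ?nnegrE//; lra.
have [hc _] := eta_tail cos (@cos_max R) (@cos_lipschitz R) t M.
have [hs cs] := eta_tail sin (@sin_max R) (@sin_lipschitz R) t M.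
have aux (a b : R) : `|a - b| <= 1 -> b ^+ 2 <= 2 * a ^+ 2 + 2.
  rewrite ler_norml => /andP[h1 h2]; have := sqr_ge0 (2 * a - b); nra.
have imE : eta_half_im t = - limn (fun M : nat => \sum_(0 <= k < M)
          (-1) ^+ k * (k.+1%:R) `^ (- 2^-1) * sin (t * ln (k.+1%:R))).
  rewrite -limN//; congr (limn _); apply/funext => N /=.
  exact: sumrN.
have := aux _ _ (le_trans hc small); have := aux _ _ (le_trans hs small).
rewrite imE sqrrN /eta_half_re /eta_cos /eta_sin; lra.
Qed.

(** The frequencies will be polynomial in [z]. With exponent [1 / (2q)], the square of
    [(1 + |t|) ^ eps] is at most [(2 * z ^ q) ^ (1/q) <= 2 * z], so the hypothesis costs a single
    factor [z]. *)
Lemma eta_partial_Lindelof {R : realType} (q : nat) : (0 < q)%N ->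
  Lindelof_hypothesis R -> exists2 K : R, 0 < K &
  forall (z t : R) (M : nat), 1 <= z -> `|t| <= z ^+ q -> (1 + 3 * z ^+ q) ^+ 2 <= M.+1%:R ->
  eta_cos M t ^+ 2 + eta_sin M t ^+ 2 <= K * z.
Proof.
move=> q0 LH.
have [K hK] := LH (2 * q%:R)^-1 ltac:(by rewrite invr_gt0 mulr_gt0// ltr0n).
exists (36 * K ^+ 2 + 4); first by have := sqr_ge0 K; lra.
move=> z t M z1 tz zM.
apply: le_trans (eta_partial_le t _ M tz zM) _.
have := eta_half_le _ _ _ (hK t); set P := _ `^ _ => h.
have P2 : P ^+ 2 <= 2 * z.
  have t0 := normr_ge0 t.
  have zq : 1 <= z ^+ q by rewrite exprn_ege1.
  have q0' : 0 < q%:R :> R by rewrite ltr0n.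
  rewrite -powR_mulrn ?powR_ge0// /P -powRrM.
  have -> : (2 * q%:R)^-1 * 2%:R = q%:R^-1 :> R by field; rewrite gt_eqF.
  apply: (@le_trans _ _ ((2 * z ^+ q) `^ (q%:R^-1))).
    by apply: ge0_ler_powR; rewrite ?invr_ge0 ?nnegrE ?ler0n//; lra.
  rewrite powRM// ?exprn_ge0; [|lra|lra].
  rewrite -powR_mulrn; last lra.
  rewrite -powRrM divff ?gt_eqF// powRr1; last lra.
  rewrite ler_pM2r; last lra.
  rewrite -[leRHS]powRr1//; apply: ler_powR; first lra.
  by rewrite invf_le1// ler1n.
rewrite exprMn in h.
have := ler_wpM2l (sqr_ge0 K) P2; lra.
Qed.

(** * The kernel *)

(** Near 0 it resembles a Gaussian of width about [1 / (theta * sqrt m)]; it has period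
    [2 pi / theta], and its frequencies are [(m - j) * theta] for [0 <= j <= 2m]. *)
Definition ker {R : realType} (theta : R) (m : nat) (x : R) : R :=
  cos (theta / 2 * x) ^+ m.*2.

(** Fourier coefficient of [ker] at the frequency [(m - j) * theta]. *)
Definition wt {R : realType} (m j : nat) : R := 'C(m.*2, j)%:R / 4 ^+ m.

Lemma ker_ge0 {R : realType} (theta : R) (m : nat) (x : R) : 0 <= ker theta m x.
Proof. by rewrite /ker -muln2 exprM sqr_ge0. Qed.

Lemma wt_ge0 {R : realType} (m j : nat) : 0 <= wt m j :> R.
Proof. by rewrite divr_ge0. Qed.

Lemma ker_cosE {R : realType} (theta : R) (m : nat) (x : R) :
  ker theta m x = \sum_(0 <= j < m.*2.+1) wt m j * cos ((m%:R - j%:R) * theta * x).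
Proof.
have [h _] := cos_exp_binomial m.*2 (theta / 2 * x).
have p4 : (4 ^+ m != 0 :> R) by rewrite expf_neq0.
apply: (mulfI p4).
have -> : 4 ^+ m * ker theta m x = (2 * cos (theta / 2 * x)) ^+ m.*2.
  by rewrite exprMn /ker -[in 2 ^+ _]muln2 mulnC exprM; congr (_ ^+ _ * _); ring.
rewrite -h mulr_sumr; apply: eq_bigr => j _.
have -> : (m.*2%:R - j.*2%:R) * (theta / 2 * x) = (m%:R - j%:R) * theta * x.
  by rewrite -!muln2 !natrM; field.
by rewrite /wt; field.
Qed.

(** The conjugate of the expansion [ker_cosE] vanishes, as [parseval] demands. *)
Lemma ker_sin_sum {R : realType} (theta : R) (m : nat) (x : R) :
  \sum_(0 <= j < m.*2.+1) wt m j * sin ((m%:R - j%:R) * theta * x) = 0.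
Proof.
have [_ h] := cos_exp_binomial m.*2 (theta / 2 * x).
transitivity ((4 ^+ m)^-1 * 0 : R); last by rewrite mulr0.
rewrite -[in RHS]h mulr_sumr; apply: eq_bigr => j _.
have -> : (m.*2%:R - j.*2%:R) * (theta / 2 * x) = (m%:R - j%:R) * theta * x.
  by rewrite -!muln2 !natrM; field.
by rewrite /wt; ring.
Qed.

Lemma parseval_ker {R : realType} (theta : R) (m : nat) (I : Type) (S : seq I)
    (a mu : I -> R) : 0 < theta ->
  has_mean (pi *+ 2 / theta)
    (fun u => (\sum_(i <- S) a i * ker theta m (u - mu i)) ^+ 2)
    (\sum_(0 <= j < m.*2.+1) wt m j ^+ 2 *
      ((\sum_(i <- S) a i * cos ((m%:R - j%:R) * theta * mu i)) ^+ 2 +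
       (\sum_(i <- S) a i * sin ((m%:R - j%:R) * theta * mu i)) ^+ 2)).
Proof.
move=> t0.
pose f j : R := (m%:R - j%:R) * theta.
pose A j := wt m j * (\sum_(i <- S) a i * cos (f j * mu i)).
pose B j := wt m j * (\sum_(i <- S) a i * sin (f j * mu i)).
have -> : (fun u => (\sum_(i <- S) a i * ker theta m (u - mu i)) ^+ 2) =
  (fun u => (\sum_(0 <= j < m.*2.+1) (A j * cos (f j * u) + B j * sin (f j * u))) ^+ 2).
  apply/funext => u; congr (_ ^+ 2).
  under eq_bigr do rewrite ker_cosE mulr_sumr.
  rewrite exchange_big/=; apply: eq_bigr => j _.
  rewrite /A /B !mulr_sumr !mulr_suml -big_split/=; apply: eq_bigr => i _.
  by rewrite mulrBr cosB /f; ring.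
have -> : \sum_(0 <= j < m.*2.+1) wt m j ^+ 2 *
      ((\sum_(i <- S) a i * cos ((m%:R - j%:R) * theta * mu i)) ^+ 2 +
       (\sum_(i <- S) a i * sin ((m%:R - j%:R) * theta * mu i)) ^+ 2) =
   \sum_(0 <= j < m.*2.+1) (A j ^+ 2 + B j ^+ 2).
  by apply: eq_bigr => j _; rewrite /A /B /f; ring.
apply: parseval => // u.
transitivity (\sum_(i <- S) a i *
    \sum_(0 <= j < m.*2.+1) wt m j * sin ((m%:R - j%:R) * theta * (u - mu i))); last first.
  by rewrite big1// => i _; rewrite ker_sin_sum mulr0.
under [RHS]eq_bigr do rewrite mulr_sumr.
rewrite [RHS]exchange_big/=; apply: eq_bigr => j _.
rewrite /A /B !mulr_sumr !mulr_suml -sumrB; apply: eq_bigr => i _.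
by rewrite (mulrBr (_ * theta)) sinB /f; ring.
Qed.

Definition alt_sum {R : realType} (theta : R) (m N : nat) (s : seq nat) (rho : nat -> R) (u : R) : R :=
  \sum_(k <- s) \sum_(0 <= n < N)
    (-1) ^+ n * (n.+1%:R) `^ (- 2^-1) * ker theta m (u + rho k - ln n.+1%:R).

(** The shifts [ln n.+1 - rho k] are differences, so at each frequency the exponential sum is a
    product of the eta polynomial with the conjugate of the sum over [rho]; its squared modulus
    factors, the cross terms cancelling. *)
Lemma alt_sum_mean {R : realType} (theta : R) (m N : nat) (s : seq nat) (rho : nat -> R) :
  0 < theta ->
  let f j := (m%:R - j%:R) * theta in
  has_mean (pi *+ 2 / theta) (fun u => alt_sum theta m N s rho u ^+ 2)
    (\sum_(0 <= j < m.*2.+1) wt m j ^+ 2 *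
      ((\sum_(k <- s) cos (f j * rho k)) ^+ 2 + (\sum_(k <- s) sin (f j * rho k)) ^+ 2) *
      (eta_cos N (f j) ^+ 2 + eta_sin N (f j) ^+ 2)).
Proof.
move=> t0 f.
have h := parseval_ker theta m _ [seq (k, n) | k <- s, n <- index_iota 0 N]
  (fun i => (-1) ^+ i.2 * (i.2.+1%:R) `^ (- 2^-1)) (fun i => ln i.2.+1%:R - rho i.1) t0.
have -> : (fun u => alt_sum theta m N s rho u ^+ 2) = (fun u : R =>
    (\sum_(i <- [seq (k, n) | k <- s, n <- index_iota 0 N])
      (-1) ^+ i.2 * i.2.+1%:R `^ (- 2^-1) * ker theta m (u - (ln i.2.+1%:R - rho i.1))) ^+ 2).
  apply/funext => u; congr (_ ^+ 2); rewrite big_allpairs_dep; apply: eq_bigr => k _.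
  by apply: eq_bigr => n _; congr (_ * ker _ _ _); rewrite /=; ring.
set c := (X in has_mean _ _ X); set c' := (X in has_mean _ _ X) in h.
suff -> : c = c' by [].
apply: eq_bigr => j _; rewrite -/(f j) -mulrA; congr (_ * _).
rewrite !big_allpairs_dep/=.
have -> : \sum_(k <- s) \sum_(0 <= n < N)
     (-1) ^+ n * n.+1%:R `^ (- 2^-1) * cos (f j * (ln n.+1%:R - rho k)) =
  (\sum_(k <- s) cos (f j * rho k)) * eta_cos N (f j) +
  (\sum_(k <- s) sin (f j * rho k)) * eta_sin N (f j).
  rewrite /eta_cos /eta_sin !mulr_suml -big_split/=; apply: eq_bigr => k _.
  rewrite !mulr_sumr -big_split/=; apply: eq_bigr => n _.
  by rewrite mulrBr cosB; ring.
have -> : \sum_(k <- s) \sum_(0 <= n < N)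
     (-1) ^+ n * n.+1%:R `^ (- 2^-1) * sin (f j * (ln n.+1%:R - rho k)) =
  (\sum_(k <- s) cos (f j * rho k)) * eta_sin N (f j) -
  (\sum_(k <- s) sin (f j * rho k)) * eta_cos N (f j).
  rewrite /eta_cos /eta_sin !mulr_suml -sumrB; apply: eq_bigr => k _.
  rewrite !mulr_sumr -sumrB; apply: eq_bigr => n _.
  by rewrite mulrBr sinB; ring.
ring.
Qed.

(** One factor [wt] is bounded by [m ^ (-1/2)] and the eta factor by [H]. With the remaining [wt],
    [ker_cosE] folds the sum over frequencies back into kernels at the differences of [rho]. *)
Lemma alt_sum_mean_le {R : realType} (theta H : R) (m N : nat) (s : seq nat) (rho : nat -> R) :
  (0 < m)%N ->
  let f j := (m%:R - j%:R) * theta in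
  (forall j, (j <= m.*2)%N -> eta_cos N (f j) ^+ 2 + eta_sin N (f j) ^+ 2 <= H) ->
  \sum_(0 <= j < m.*2.+1) wt m j ^+ 2 *
      ((\sum_(k <- s) cos (f j * rho k)) ^+ 2 + (\sum_(k <- s) sin (f j * rho k)) ^+ 2) *
      (eta_cos N (f j) ^+ 2 + eta_sin N (f j) ^+ 2) <=
  H / Num.sqrt m%:R * \sum_(k <- s) \sum_(l <- s) ker theta m (rho k - rho l).
Proof.
move=> m0 f hH.
have -> : \sum_(k <- s) \sum_(l <- s) ker theta m (rho k - rho l) =
   \sum_(0 <= j < m.*2.+1) wt m j *
      ((\sum_(k <- s) cos (f j * rho k)) ^+ 2 + (\sum_(k <- s) sin (f j * rho k)) ^+ 2).
  under [RHS]eq_bigr do rewrite !expr2 !big_distrlr/= -big_split/= mulr_sumr.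
  rewrite [RHS]exchange_big/=; apply: eq_bigr => k _.
  under [RHS]eq_bigr do rewrite -big_split/= mulr_sumr.
  rewrite [RHS]exchange_big/=; apply: eq_bigr => l _.
  by rewrite ker_cosE; apply: eq_bigr => j _; rewrite mulrBr cosB.
rewrite mulr_sumr big_nat [leRHS]big_nat; apply: ler_sum => j /= jm.
have w0 := @wt_ge0 R m j.
have w1 := bin_weight_le m j m0 : wt m j <= _ :> R.
set P := _ + (\sum_(k <- s) sin _) ^+ 2; set E := _ + eta_sin _ _ ^+ 2.
have P0 : 0 <= P by rewrite addr_ge0 ?sqr_ge0.
have E0 : 0 <= E by rewrite addr_ge0 ?sqr_ge0.
have EH : E <= H by apply: hH; lia.
have -> : wt m j ^+ 2 * P * E = (wt m j * P) * (E * wt m j) by ring.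
rewrite [leRHS]mulrC; apply: ler_wpM2l; first exact: mulr_ge0.
exact: ler_pM.
Qed.

(** With [y = theta * x / 2] in [[-1, 1]], this is [cos y ^ 2 <= 1 - y ^ 2 / 4] raised to the power
    [m]. *)
Lemma ker_le_exp {R : realType} (theta x : R) (m : nat) :
  0 <= theta -> theta * `|x| <= 2 ->
  ker theta m x <= expR (- (m%:R * (theta * x) ^+ 2 / 16)).
Proof.
move=> t0 tx; rewrite /ker -muln2 mulnC exprM.
have a1 : `|theta / 2 * x| <= 1.
  by rewrite normrM ger0_norm ?divr_ge0//; lra.
have := sqr_cos_le _ a1; set y := _ / 2 * x => h.
have -> : - (m%:R * (theta * x) ^+ 2 / 16) = - (m%:R * (y ^+ 2 / 4)).
  by rewrite /y; field.
apply: le_trans (one_sub_exp_le _ _ _).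
  by rewrite lerXn2r ?nnegrE ?sqr_ge0//; apply: le_trans (sqr_ge0 _) h.
by have := sqr_ge0 (cos y); lra.
Qed.

(** Bernoulli's inequality: [(1 - y ^ 2 / 2) ^ (2m) >= 1 - m * y ^ 2], where [m * y ^ 2 <= 1 / 2]
    for [y = theta * x / 2]. *)
Lemma ker_ge_half {R : realType} (theta x T : R) (m : nat) :
  m%:R * theta ^+ 2 <= 2 * T ^+ 2 -> T * `|x| <= 1 -> 0 < T ->
  (0 < m)%N -> 2^-1 <= ker theta m x.
Proof.
move=> mT Tx T0 m0; set y := theta / 2 * x.
have hc : 1 - y ^+ 2 / 2 <= cos y := cos_ge_quadratic y.
have Tx2 : T ^+ 2 * x ^+ 2 <= 1.
  have -> : T ^+ 2 * x ^+ 2 = (T * `|x|) ^+ 2 by rewrite exprMn real_normK ?num_real.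
  by rewrite exprn_ile1// mulr_ge0// ltW.
have my : m%:R * y ^+ 2 <= 2^-1.
  have -> : m%:R * y ^+ 2 = m%:R * theta ^+ 2 * x ^+ 2 / 4 by rewrite /y; field.
  have := ler_wpM2r (sqr_ge0 x) mT; lra.
have y2 : y ^+ 2 <= 1.
  have : 1 * y ^+ 2 <= m%:R * y ^+ 2 by rewrite ler_wpM2r ?sqr_ge0// ler1n.
  lra.
have bern (w : R) n : 0 <= w <= 1 -> 1 - n%:R * w <= (1 - w) ^+ n.
  move=> /andP[w0 w1]; elim: n => [|n IH]; first by rewrite expr0 mul0r subr0.
  have := ler_wpM2r (_ : 0 <= 1 - w) IH; rewrite exprSr -natr1.
  by move=> /(_ ltac:(lra)); have := mulr_ge0 (ler0n R n) (sqr_ge0 w); lra.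
rewrite /ker -/y.
apply: (@le_trans _ _ ((1 - y ^+ 2 / 2) ^+ m.*2)); last first.
  by rewrite lerXn2r ?nnegrE//; have := sqr_ge0 y; lra.
have b := bern (y ^+ 2 / 2) m.*2.
apply: le_trans (b _); last by apply/andP; have := sqr_ge0 y; split; lra.
rewrite -muln2 natrM; lra.
Qed.

(** * Spaced points and dilated sums *)

(** A substitute for [1 / j ^ 2] whose sum telescopes; the 6 is the least constant with
    [(j + 1)(j + 2) <= 6 * j ^ 2] for all [j >= 1]. *)
Definition telescoping_weight {R : realType} (j : nat) : R := 6 / (j.+1%:R * j.+2%:R).

Lemma telescoping_weight_ge0 {R : realType} j : 0 <= telescoping_weight j :> R.
Proof. by rewrite divr_ge0// mulr_ge0. Qed.

Lemma telescoping_weight_sum {R : realType} n : \sum_(0 <= j < n) telescoping_weight j <= 6 :> R.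
Proof.
have h : \sum_(0 <= j < n) telescoping_weight j = 6 - 6 / n.+1%:R :> R.
  elim: n => [|n IH]; first by rewrite big_geq// divr1 subrr.
  rewrite big_nat_recr//= IH /telescoping_weight -(natr1 n.+1) -(natr1 n).
  have n0 := ler0n R n.
  by field; rewrite !gt_eqF//; lra.
by rewrite h gerBl divr_ge0.
Qed.

(** With truncated subtraction, [(k - l) + (l - k)] is the distance from [k] to [l]. Each side of
    [k] contributes at most 6. *)
Lemma telescoping_weight_dist_sum {R : realType} (s : seq nat) (k : nat) : uniq s ->
  \sum_(l <- s) telescoping_weight ((k - l) + (l - k))%N <= 12 :> R.
Proof.
move=> us; pose B := (\max_(l <- s) l).+1.
have sB l : l \in s -> (l < k + B)%N.
  by move=> ls; rewrite /B addnS ltnS (leq_trans (leq_bigmax_seq _ ls isT))// leq_addl.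
have pe : perm_eq s [seq l <- index_iota 0 (k + B) | l \in s].
  apply: uniq_perm => //; first by rewrite filter_uniq// iota_uniq.
  move=> l; rewrite mem_filter mem_index_iota leq0n /=.
  by case: (boolP (l \in s)) => //= /sB ->.
rewrite (perm_big _ pe)/= big_filter.
apply: (@le_trans _ _ (\sum_(0 <= l < k + B) telescoping_weight ((k - l) + (l - k))%N)).
  rewrite [leLHS]big_mkcond/=; apply: ler_sum => l _.
  by case: ifP => // _; exact: telescoping_weight_ge0.
rewrite (big_cat_nat _ (leq_addr B k))//=.
rewrite (_ : 12 = 6 + 6 :> R); last by ring.
apply: lerD.
- rewrite big_nat_rev/= add0n.
  apply: le_trans (telescoping_weight_sum k.+1); rewrite big_nat_recl//=.
  rewrite -[leLHS]add0r; apply: lerD; first exact: telescoping_weight_ge0.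
  rewrite big_nat [leRHS]big_nat; apply: ler_sum => l /andP[_ lk].
  by rewrite (_ : (_ + _)%N = l.+1)//; lia.
- rewrite -{1}[k]add0n big_addn addKn.
  apply: le_trans (telescoping_weight_sum B); apply: ler_sum => l _.
  by rewrite (_ : (_ + _)%N = l)//; lia.
Qed.

Lemma ln_dist_ge {R : realType} (Y a b : R) : 0 < Y -> Y <= a <= 2 * Y -> Y <= b <= 2 * Y ->
  `|a - b| <= 2 * Y * `|ln a - ln b|.
Proof.
move=> Y0.
wlog ba : a b / b <= a => [hw ha hb|].
  have [/hw|/ltW/hw] := leP b a; first exact.
  by rewrite distrC [`|ln b - _|]distrC; apply.
move=> /andP[a1 a2] /andP[b1 b2].
have a0 : 0 < a by lra.
have b0 : 0 < b by lra.
rewrite !ger0_norm ?subr_ge0// ?ler_ln ?posrE//.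
have : ln (b / a) <= b / a - 1.
  have := @le_ln1Dx R (b / a - 1); rewrite (addrC 1) subrK; apply.
  by rewrite ltrBrDl subrr divr_gt0.
rewrite !ln_div ?posrE// => h.
have h2 : 1 - b / a <= ln a - ln b by lra.
have := ler_wpM2l (ltW a0) h2.
have -> : a * (1 - b / a) = a - b by field; rewrite gt_eqF.
move=> /le_trans; apply; apply: ler_wpM2r => //.
by rewrite subr_ge0 ler_ln ?posrE.
Qed.

Lemma ker_le1 {R : realType} (theta x : R) m : ker theta m x <= 1.
Proof.
rewrite /ker -muln2 mulnC exprM exprn_ile1 ?sqr_ge0//.
Qed.

(** Only the near-diagonal counts. Integer parts at distance [j >= 2] give [|d k - d l| >= j / 2],
    so the logarithms differ by at least [j / (4Y)]; as the kernel has width at most about [1 / Y],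
    Gaussian decay and [exp (- w) <= 1 / w] leave [256 / j ^ 2]. *)
Lemma ker_spacing {R : realType} (theta Y : R) (m : nat) (s : seq nat) (d : nat -> R) :
  0 < Y -> 0 < theta <= 1 -> Y ^+ 2 <= m%:R * theta ^+ 2 -> uniq s ->
  (forall k, k \in s -> k%:R <= d k < k.+1%:R /\ Y <= d k <= 2 * Y) ->
  \sum_(k <- s) \sum_(l <- s) ker theta m (ln (d k) - ln (d l)) <= 256 * 12 * (size s)%:R.
Proof.
move=> Y0 /andP[t0 t1] mY us hs.
have key k l : k \in s -> l \in s ->
    ker theta m (ln (d k) - ln (d l)) <= 256 * telescoping_weight ((k - l) + (l - k))%N.
  move=> /hs[/andP[k1 k2] kY] /hs[/andP[l1 l2] lY].
  set j := (_ + _)%N; have [j1|j1] := leqP j 1.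
    apply: le_trans (ker_le1 _ _ _) _; rewrite /telescoping_weight.
    case: j j1 => [|[|//]] _; lra.
  have jd : j%:R / 2 <= `|d k - d l|.
    have [kl|lk] := leqP k l.
    - have jE : j%:R = l%:R - k%:R :> R.
        by rewrite -natrB// /j (eqP kl) add0n.
      have j2 : 2 <= j%:R :> R by rewrite (ler_nat _ 2).
      rewrite distrC ger0_norm; rewrite -natr1 in k2; lra.
    - have jE : j%:R = k%:R - l%:R :> R.
        by rewrite -natrB 1?ltnW// /j (eqP (ltnW lk)) addn0.
      have j2 : 2 <= j%:R :> R by rewrite (ler_nat _ 2).
      rewrite ger0_norm; rewrite -natr1 in l2; lra.
  set x := ln (d k) - ln (d l).
  have dx : `|d k - d l| <= 2 * Y * `|x| := ln_dist_ge Y _ _ Y0 kY lY.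
  have j2 : 2 <= j%:R :> R by rewrite (ler_nat _ 2).
  have x0 : 0 < `|x|.
    have : 0 < 2 * Y * `|x| by lra.
    by rewrite pmulr_rgt0//; lra.
  have lnle (a b : R) : Y <= a <= 2 * Y -> Y <= b <= 2 * Y -> ln a - ln b <= 1.
    move=> /andP[a1 a2] /andP[b1 b2].
    have a0 : 0 < a by lra.
    have b0 : 0 < b by lra.
    rewrite -ln_div ?posrE//.
    have := @le_ln1Dx R (a / b - 1); rewrite (addrC 1) subrK => /(_ _)/le_trans; apply.
      by rewrite ltrBrDl subrr divr_gt0.
    by rewrite lerBlDr ler_pdivrMr//; lra.
  have x1 : `|x| <= 1.
    by rewrite ler_norml /x; have := lnle _ _ kY lY; have := lnle _ _ lY kY; lra.
  have tx : theta * `|x| <= 2.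
    have : theta * `|x| <= 1 * 1 by rewrite ler_pM// ltW.
    lra.
  apply: le_trans (ker_le_exp _ _ m (ltW t0) tx) _.
  have jx : j%:R ^+ 2 <= 16 * (m%:R * (theta * x) ^+ 2).
    have : (j%:R / 2) ^+ 2 <= (2 * Y * `|x|) ^+ 2.
      by rewrite lerXn2r ?nnegrE//; lra.
    rewrite exprMn [in X in _ <= X -> _]exprMn real_normK ?num_real// !exprMn => h.
    have := ler_wpM2r (sqr_ge0 x) mY; lra.
  have mp : 0 < m%:R * (theta * x) ^+ 2 / 16.
    by have : 0 < j%:R ^+ 2 :> R; [rewrite exprn_gt0//; lra|lra].
  apply: (le_trans (expRN_le_inv _ mp)).
  have jj : 0 < j%:R ^+ 2 / 256 :> R by have : 0 < j%:R ^+ 2 :> R; [rewrite exprn_gt0//; lra|lra].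
  apply: (@le_trans _ _ (j%:R ^+ 2 / 256)^-1).
    by rewrite lef_pV2 ?posrE//; lra.
  rewrite invf_div /telescoping_weight -(natr1 j.+1) -(natr1 j) ler_pM2l ?ltr0n//.
  rewrite ler_pdivlMr; last by nra.
  by rewrite mulrC ler_pdivrMr; nra.
rewrite (_ : 256 * 12 * (size s)%:R = \sum_(k <- s) (256 * 12 : R)); last first.
  by rewrite big_const_seq count_predT iter_addr addr0 mulr_natr.
rewrite big_seq [leRHS]big_seq; apply: ler_sum => k ks.
apply: (@le_trans _ _ (\sum_(l <- s) 256 * telescoping_weight ((k - l) + (l - k))%N)).
  by rewrite big_seq [leRHS]big_seq; apply: ler_sum => l ls; exact: key.
rewrite -mulr_sumr.
have := ler_wpM2l (ler0n R 256) (telescoping_weight_dist_sum s k us); lra.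
Qed.

Lemma powR_inv_sqrt {R : realType} n : (n%:R : R) `^ (- 2^-1) = (Num.sqrt n%:R)^-1.
Proof. by rewrite powRN powR12_sqrt ?ler0n. Qed.

(** This is [S_i]: since [2 ^ (-i/2) * n ^ (-1/2) = 2 ^ (-i) * (n / 2 ^ i) ^ (-1/2)], it is a
    Riemann sum over the points [n / 2 ^ i] up to [N], with spacing [2 ^ (-i)]. *)
Definition dilated_sum {R : realType} (theta : R) (m N i : nat) (s : seq nat) (rho : nat -> R) (u : R) : R :=
  (Num.sqrt 2)^-1 ^+ i * \sum_(k <- s) \sum_(0 <= n < 2 ^ i * N)
     (n.+1%:R) `^ (- 2^-1) * ker theta m (u + (rho k + i%:R * ln 2) - ln n.+1%:R).

Lemma big_nat_double {R : realType} (F : nat -> R) N :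
  \sum_(0 <= n < N.*2) F n = \sum_(0 <= j < N) (F j.*2 + F j.*2.+1).
Proof.
elim: N => [|N IH]; first by rewrite !big_geq.
by rewrite doubleS !big_nat_recr//= IH addrA.
Qed.

(* The even terms of level [i.+1] make up half of level [i], so that odd minus
   even terms is the difference of the two levels. *)
Lemma dilated_sum_step {R : realType} (theta : R) (m N i : nat) (s : seq nat) (rho : nat -> R) (u : R) :
  dilated_sum theta m N i.+1 s rho u - dilated_sum theta m N i s rho u =
  (Num.sqrt 2)^-1 ^+ i.+1 *
    alt_sum theta m (2 ^ i.+1 * N) s (fun k => rho k + i.+1%:R * ln 2) u.
Proof.
have s0 : 0 < Num.sqrt 2 :> R by rewrite sqrtr_gt0.
have half2 (y : R) : (Num.sqrt 2)^-1 * (2 * ((Num.sqrt 2)^-1 * y)) = y.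
  have ss : Num.sqrt 2 ^+ 2 = 2 :> R by rewrite sqr_sqrtr.
  move: (Num.sqrt 2) s0 ss => q q0 <-.
  by field; rewrite gt_eqF.
have -> : dilated_sum theta m N i s rho u = (Num.sqrt 2)^-1 ^+ i.+1 *
   (\sum_(k <- s) \sum_(0 <= n < 2 ^ i * N) 2 *
     ((n.*2.+2%:R) `^ (- 2^-1) * ker theta m (u + (rho k + i.+1%:R * ln 2) - ln n.*2.+2%:R))).
  rewrite /dilated_sum exprSr -mulrA; congr (_ * _).
  rewrite mulr_sumr; apply: eq_bigr => k _; rewrite mulr_sumr; apply: eq_bigr => n _.
  have -> : n.*2.+2%:R = 2 * n.+1%:R :> R by rewrite -natrM; congr (_%:R); lia.
  rewrite powRM ?ler0n// (powR_inv_sqrt 2) lnM ?posrE ?ltr0n//.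
  have -> : u + (rho k + i%:R * ln 2) - ln n.+1%:R =
     u + (rho k + i.+1%:R * ln 2) - (ln 2 + ln n.+1%:R) by rewrite -natr1; ring.
  by rewrite -[in RHS]mulrA half2.
rewrite /dilated_sum /alt_sum -mulrBr -sumrB; congr (_ * _); apply: eq_bigr => k _.
have -> : (2 ^ i.+1 * N = (2 ^ i * N).*2)%N by rewrite expnS; lia.
rewrite !big_nat_double -sumrB; apply: eq_bigr => j _.
rewrite exprS -mul2n exprM sqrrN !expr1n; ring.
Qed.

Lemma dilated_sum_telescope {R : realType} (theta : R) (m N J : nat) (s : seq nat) (rho : nat -> R) (u : R) :
  dilated_sum theta m N J s rho u - dilated_sum theta m N 0 s rho u =
  \sum_(0 <= i < J) (Num.sqrt 2)^-1 ^+ i.+1 *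
    alt_sum theta m (2 ^ i.+1 * N) s (fun k => rho k + i.+1%:R * ln 2) u.
Proof.
under eq_bigr do rewrite -dilated_sum_step.
by rewrite telescope_sumr.
Qed.

(** The integers [n.+1] with [a <= n < a + b] lie above [V] within relative distance [1 / T]. As
    [V / T >= 2], rounding [V / T] down loses at most half. *)
Lemma nat_window {R : realType} (V T : R) : 1 <= T -> 2 * T <= V ->
  exists a b : nat, [/\ V / (2 * T) <= b%:R, a%:R + b%:R <= V + V / T &
     forall n, (a <= n)%N -> V <= n.+1%:R].
Proof.
move=> T1 TV; have V0 : 0 <= V by lra.
have T0 : 0 < T by lra.
have /andP[a1 a2] := truncn_itv V0.
have VT0 : 0 <= V / T by rewrite divr_ge0// ltW.
have /andP[b1 b2] := truncn_itv VT0.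
exists (Num.truncn V), (Num.truncn (V / T)); split.
- have VT2 : 2 <= V / T by rewrite ler_pdivlMr.
  have -> : V / (2 * T) = V / T / 2 by field; rewrite gt_eqF.
  rewrite -natr1 in b2; lra.
- lra.
- by move=> n an; apply: (le_trans (ltW a2)); rewrite ler_nat.
Qed.

(** All terms are nonnegative, so it suffices to keep, for each [k], the window of [nat_window] at
    [V = expR (u + rho k) * 2 ^+ J]. There the kernel is at least [1 / 2] and [n.+1 <= 4 * V], and
    the powers of [sqrt 2] cancel. *)
Lemma dilated_sum_ge {R : realType} (theta T W u : R) (m N J : nat) (s : seq nat) (rho : nat -> R) :
  1 <= T -> (0 < m)%N -> m%:R * theta ^+ 2 <= 2 * T ^+ 2 -> 0 <= W ->
  (forall k, k \in s -> [/\ 2 * T <= expR (u + rho k) * 2 ^+ J,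
     2 * expR (u + rho k) <= N%:R & W <= expR (u + rho k)]) ->
  (size s)%:R * (Num.sqrt W / (8 * T)) <= dilated_sum theta m N J s rho u.
Proof.
move=> T1 m0 mT W0 hs; have T0 : 0 < T by lra.
have s2 : 0 < Num.sqrt 2 :> R by rewrite sqrtr_gt0.
rewrite /dilated_sum mulr_sumr.
rewrite (_ : (size s)%:R * _ = \sum_(k <- s) (Num.sqrt W / (8 * T))); last first.
  by rewrite big_const_seq count_predT iter_addr addr0 mulr_natl.
rewrite big_seq [leRHS]big_seq; apply: ler_sum => k /hs[h1 h2 h3].
pose V := expR (u + rho k) * 2 ^+ J.
have VT : 2 * T <= V by [].
have V0 : 0 < V by lra.
have [a [b [b1 ab an]]] := nat_window V T T1 VT.
have VV : V / T <= V by rewrite ler_pdivrMr// ler_peMr// ltW.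
have abN : (a + b <= 2 ^ J * N)%N.
  rewrite -(ler_nat R) natrD natrM natrX; apply: (le_trans ab).
  apply: (@le_trans _ _ (2 * V)); first lra.
  rewrite /V mulrA [leRHS]mulrC ler_pM2r// exprn_gt0//.
have lnV : ln V = u + (rho k + J%:R * ln 2).
  by rewrite /V lnM ?posrE ?expR_gt0 ?exprn_gt0// expRK lnXn// mulr_natl addrA.
pose F n : R := n.+1%:R `^ (- 2^-1) * ker theta m (u + (rho k + J%:R * ln 2) - ln n.+1%:R).
have F0 n : 0 <= F n by rewrite mulr_ge0 ?powR_ge0 ?ker_ge0.
have sub : \sum_(a <= n < a + b) F n <= \sum_(0 <= n < 2 ^ J * N) F n.
  rewrite (big_cat_nat (leq0n (a + b)) abN)/= (big_cat_nat (leq0n a) (leq_addr b a))/=.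
  by rewrite addrAC lerDr addr_ge0// sumr_ge0.
have low n : (a <= n < a + b)%N -> (Num.sqrt V)^-1 / 4 <= F n.
  move=> /andP[an' nb].
  have nV : V <= n.+1%:R := an n an'.
  have nV2 : n.+1%:R <= V + V / T.
    by apply: le_trans ab; rewrite -natrD ler_nat.
  have n2 : n.+1%:R <= 4 * V by lra.
  rewrite /F powR_inv_sqrt -lnV.
  have k2 : 2^-1 <= ker theta m (ln V - ln n.+1%:R).
    apply: (@ker_ge_half _ _ _ T) => //.
    rewrite distrC ger0_norm ?subr_ge0 ?ler_ln ?posrE ?ltr0n//.
    rewrite -ln_div ?posrE ?ltr0n// mulrC -ler_pdivlMr// mul1r.
    have := @le_ln1Dx R (n.+1%:R / V - 1); rewrite (addrC 1) subrK => /(_ _)/le_trans; apply.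
      by rewrite ltrBrDl subrr divr_gt0// ltr0n.
    rewrite lerBlDr ler_pdivrMr//.
    by have -> : (T^-1 + 1) * V = V + V / T by ring.
  have -> : (Num.sqrt V)^-1 / 4 = (Num.sqrt V)^-1 / 2 * 2^-1 by field; rewrite gt_eqF ?sqrtr_gt0.
  have sn : 0 < Num.sqrt n.+1%:R :> R by rewrite sqrtr_gt0 ltr0n.
  apply: ler_pM => //.
  rewrite -invfM lef_pV2 ?posrE ?mulr_gt0 ?sqrtr_gt0//.
  rewrite -(@ler_pXn2r _ 2)// ?nnegrE ?mulr_ge0 ?sqrtr_ge0//.
  rewrite exprMn !sqr_sqrtr ?ler0n// ?(ltW V0)//; lra.
have low2 : b%:R * ((Num.sqrt V)^-1 / 4) <= \sum_(a <= n < a + b) F n.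
  rewrite (_ : b%:R * _ = \sum_(a <= n < a + b) ((Num.sqrt V)^-1 / 4)); last first.
    by rewrite big_const_nat iter_addr addr0 addKn mulr_natl.
  by rewrite big_nat [leRHS]big_nat; apply: ler_sum.
apply: (@le_trans _ _ ((Num.sqrt 2)^-1 ^+ J * (V / (2 * T) * ((Num.sqrt V)^-1 / 4)))); last first.
  rewrite ler_pM2l ?exprn_gt0 ?invr_gt0//.
  apply: (le_trans _ sub); apply: (le_trans _ low2).
  by rewrite ler_pM2r// divr_gt0// invr_gt0 sqrtr_gt0.
have sV : Num.sqrt V = Num.sqrt (expR (u + rho k)) * Num.sqrt 2 ^+ J.
  have s2J : Num.sqrt (2 ^+ J) = Num.sqrt 2 ^+ J :> R.
    elim: J {hs h1 V VT V0 a b b1 ab an VV abN lnV F F0 sub low low2} => [|J IH].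
      by rewrite !expr0 sqrtr1.
    by rewrite !exprS sqrtrM// IH.
  by rewrite /V sqrtrM ?expR_ge0// s2J.
have -> : (Num.sqrt 2)^-1 ^+ J * (V / (2 * T) * ((Num.sqrt V)^-1 / 4)) =
   Num.sqrt (expR (u + rho k)) / (8 * T).
  have -> : V = Num.sqrt V ^+ 2 by rewrite sqr_sqrtr// ltW.
  rewrite sqrtr_sqr ger0_norm ?sqrtr_ge0// sV exprVn.
  have e0 : 0 < Num.sqrt (expR (u + rho k)) by rewrite sqrtr_gt0 expR_gt0.
  have : 0 < Num.sqrt 2 ^+ J :> R by rewrite exprn_gt0.
  move: (Num.sqrt 2 ^+ J) => y y0.
  by field; rewrite !gt_eqF.
rewrite ler_pM2r ?invr_gt0 ?mulr_gt0//.
by rewrite ler_sqrt// expR_gt0.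
Qed.

Lemma dilated_sum0_le {R : realType} (theta del u : R) (m N : nat) (s : seq nat) (rho : nat -> R) :
  (forall k n, k \in s -> (n < N)%N -> ker theta m (u + rho k - ln n.+1%:R) <= del) ->
  dilated_sum theta m N 0 s rho u <= (size s)%:R * (N%:R * del).
Proof.
move=> h; rewrite /dilated_sum expr0 mul1r expn0 mul1n.
rewrite (_ : (size s)%:R * _ = \sum_(k <- s) (N%:R * del)); last first.
  by rewrite big_const_seq count_predT iter_addr addr0 mulr_natl.
rewrite big_seq [leRHS]big_seq; apply: ler_sum => k ks.
rewrite (_ : N%:R * _ = \sum_(0 <= n < N) del); last first.
  by rewrite big_const_nat iter_addr addr0 subn0 mulr_natl.
rewrite big_nat [leRHS]big_nat; apply: ler_sum => n /andP[_ nN].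
rewrite mul0r addr0; apply: (le_trans _ (h k n ks nN)).
rewrite ler_piMl ?ker_ge0// powR_inv_sqrt invf_le1 ?sqrtr_gt0 ?ltr0n//.
by rewrite -[leLHS]sqrtr1 ler_sqrt ?ler1n// ltr0n.
Qed.

Lemma dist_le_ln {R : realType} (a b : R) : 0 < a -> 0 < b -> `|ln a - ln b| <= 1 / 2 ->
  `|a - b| <= 2 * a * `|ln a - ln b|.
Proof.
move=> a0 b0.
have main (x y : R) : 0 < x -> 0 < y -> 1 - y / x <= ln x - ln y.
  move=> x0 y0; have := @le_ln1Dx R (y / x - 1); rewrite (addrC 1) subrK ln_div ?posrE// => h.
  by have := h ltac:(by rewrite ltrBrDl subrr divr_gt0); lra.
have [ba|ab] := leP b a.
  have l1 : ln b <= ln a by rewrite ler_ln ?posrE.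
  have l0 : 0 <= ln a - ln b by rewrite subr_ge0.
  rewrite !ger0_norm ?subr_ge0// => _.
  have := ler_wpM2l (ltW a0) (main a b a0 b0).
  have -> : a * (1 - b / a) = a - b by field; rewrite gt_eqF.
  have := mulr_ge0 (ltW a0) l0; lra.
have l1 : ln a <= ln b by rewrite ler_ln ?posrE// ltW.
have l0 : 0 <= ln b - ln a by rewrite subr_ge0.
rewrite (distrC a b) (distrC (ln a)) !ger0_norm ?subr_ge0 ?(ltW ab)// => h.
have := ler_wpM2l (ltW b0) (main b a b0 a0).
have -> : b * (1 - a / b) = b - a by field; rewrite gt_eqF.
move=> h2.
have b2a : b <= 2 * a.
  have : b * (ln b - ln a) <= b * (1 / 2) by rewrite ler_pM2l.
  lra.
by apply: (le_trans h2); rewrite ler_wpM2r.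
Qed.

Lemma continuous_sum {R : realType} {I : Type} (s : seq I) (f : I -> R -> R) :
  (forall i, continuous (f i)) -> continuous (fun u => \sum_(i <- s) f i u).
Proof.
move=> cf; elim: s => [|i s IH] u.
  by under eq_fun do rewrite big_nil; exact: cvg_cst.
by under eq_fun do rewrite big_cons; apply: cvgD; [exact: cf|exact: IH].
Qed.

Lemma continuous_alt_sum {R : realType} (theta : R) (m N : nat) (s : seq nat) (rho : nat -> R) :
  continuous (alt_sum theta m N s rho).
Proof.
apply: continuous_sum => k; apply: continuous_sum => n u.
apply: cvgMr; rewrite /ker.
apply: (@continuous_comp _ _ _ (fun u => cos (theta / 2 * (u + rho k - ln n.+1%:R)))
  (fun y => y ^+ m.*2)); last exact: exprn_continuous.
apply: (@continuous_comp _ _ _ (fun u => theta / 2 * (u + rho k - ln n.+1%:R)) cos); last first.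
  exact: continuous_cos.
apply: cvgMr; apply: cvgB; last exact: cvg_cst.
by apply: cvgD; [exact: cvg_id|exact: cvg_cst].
Qed.

Lemma sqr_sum_le {R : realType} (J : nat) (x : nat -> R) :
  (\sum_(0 <= i < J) x i) ^+ 2 <= J%:R * \sum_(0 <= i < J) x i ^+ 2.
Proof.
elim: J => [|J IH]; first by rewrite !big_geq// expr0n mul0r.
rewrite !big_nat_recr//= -natr1.
set S := \sum_(_ <= _ < _) x _; set Q := \sum_(_ <= _ < _) _.
have h : 2 * S * x J <= Q + J%:R * x J ^+ 2.
  case: J @S @Q IH => [|J] S Q IH; first by rewrite /S /Q !big_geq// mulr0 !mul0r addr0.
  have J0 : 0 < J.+1%:R :> R by rewrite ltr0n.
  rewrite -(ler_pM2l J0).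
  by have := sqr_ge0 (S - J.+1%:R * x J.+1); move: IH; rewrite -/S -/Q; nra.
move: IH; rewrite -/S -/Q => IH; lra.
Qed.

Lemma mul_le_exp2 (kap : nat) : exists l0 : nat, forall l, (l0 <= l)%N -> (kap * l <= 2 ^ l)%N.
Proof.
exists (maxn kap 4) => l; rewrite geq_max => /andP[kl l4].
apply: (@leq_trans (l * l)); first by rewrite leq_mul2r kl orbT.
elim: l l4 {kl} => // l IH; rewrite leq_eqVlt => /predU1P[<-//|l4].
have := IH l4; rewrite expnS; nia.
Qed.

(** * The exceptional set at one scale *)

(** If every kernel value is at most [del], then [S_0] is at most half the lower bound for [S_J], so
    the telescoped sum is large. Cauchy-Schwarz over the [J] levels makes [f] large, and Markov's
    inequality bounds where this can happen. *)
Lemma bad_measure {R : realType} (theta H T A Y del : R) (m N J : nat) (s : seq nat) (d : nat -> R) :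
  0 < theta <= 1 -> 1 <= A -> 2 * ln A <= pi *+ 2 / theta -> 1 <= T ->
  T ^+ 2 <= m%:R * theta ^+ 2 <= 2 * T ^+ 2 -> 0 < Y <= T -> 0 <= H ->
  uniq s -> (0 < size s)%N ->
  (forall k, k \in s -> k%:R <= d k < k.+1%:R /\ Y <= d k <= 2 * Y) ->
  (forall i j, (j <= m.*2)%N ->
     eta_cos (2 ^ i * N) ((m%:R - j%:R) * theta) ^+ 2 +
     eta_sin (2 ^ i * N) ((m%:R - j%:R) * theta) ^+ 2 <= H) ->
  2 * T * A <= Y * 2 ^+ J -> 4 * A * Y <= N%:R ->
  N%:R * del <= Num.sqrt (Y / A) / (16 * T) ->
  exists E : set R, [/\ measurable E,
    (lebesgue_measure E <=
      (2048 * (256 * 12) * A ^+ 2 * J%:R ^+ 2 * H * T / ((size s)%:R * Y))%:E)%E &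
    forall al, A^-1 <= al <= A ->
      (forall k n, k \in s -> (n < N)%N -> ker theta m (ln (al * d k) - ln n.+1%:R) <= del) ->
      E al].
Proof.
move=> /andP[t0 t1] A1 LA T1 /andP[mT1 mT2] /andP[Y0 YT] H0 us s0 hs hH hJ hN hdel.
have [K KE] : exists K : R, K = 256 * 12 by exists (256 * 12).
have K1 : 0 <= K by rewrite KE; exact: (mulr_ge0 (ler0n R 256) (ler0n R 12)).
rewrite -KE.
have A0 : 0 < A by lra.
have T0 : 0 < T by lra.
have m0 : (0 < m)%N.
  rewrite lt0n; apply/negP => /eqP m0; move: mT1; rewrite m0 mul0r.
  have : 0 < T ^+ 2 by rewrite exprn_gt0. lra.
pose M : R := (size s)%:R.
have M0 : 0 < M by rewrite ltr0n.
pose r : R := (Num.sqrt 2)^-1.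
have s2 : 0 < Num.sqrt 2 :> R by rewrite sqrtr_gt0.
have r01 : 0 <= r <= 1.
  rewrite invr_ge0 ltW//= invf_le1// -[leLHS]sqrtr1 ler_sqrt ?ltr0n//; lra.
pose rho k := ln (d k).
pose al_ i u := alt_sum theta m (2 ^ i.+1 * N) s (fun k => rho k + i.+1%:R * ln 2) u.
pose f u := J%:R * \sum_(0 <= i < J) (r ^+ i.+1) ^+ 2 * (al_ i u) ^+ 2.
pose c0 i : R := \sum_(0 <= j < m.*2.+1) wt m j ^+ 2 *
      ((\sum_(k <- s) cos ((m%:R - j%:R) * theta * (rho k + i.+1%:R * ln 2))) ^+ 2 +
       (\sum_(k <- s) sin ((m%:R - j%:R) * theta * (rho k + i.+1%:R * ln 2))) ^+ 2) *
      (eta_cos (2 ^ i.+1 * N) ((m%:R - j%:R) * theta) ^+ 2 +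
       eta_sin (2 ^ i.+1 * N) ((m%:R - j%:R) * theta) ^+ 2).
pose c := J%:R * \sum_(0 <= i < J) (r ^+ i.+1) ^+ 2 * c0 i.
have mf : has_mean (pi *+ 2 / theta) f c.
  apply: has_meanZ; apply: has_mean_sum => i _; apply: has_meanZ.
  exact: alt_sum_mean.
have c0le i : c0 i <= H / Num.sqrt m%:R * (K * M).
  apply: le_trans (alt_sum_mean_le theta H m (2 ^ i.+1 * N) s
    (fun k => rho k + i.+1%:R * ln 2) m0 (hH i.+1)) _.
  apply: ler_wpM2l; first by rewrite divr_ge0// sqrtr_ge0.
  (* The common shift [i.+1 * ln 2] cancels in the differences, so the spacing bound is uniform in
     the level. *)
  under eq_bigr do under eq_bigr do rewrite opprD addrACA subrr addr0.
  rewrite KE; apply: (ker_spacing theta Y) => //; first by rewrite t0 t1.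
  by apply: (le_trans _ mT1); rewrite lerXn2r ?nnegrE// ltW.
have K0 : 0 <= H / Num.sqrt m%:R * (K * M).
  by rewrite mulr_ge0 ?divr_ge0 ?sqrtr_ge0 ?mulr_ge0 ?(ltW M0).
have cle : c <= J%:R ^+ 2 * (H / Num.sqrt m%:R * (K * M)).
  rewrite /c expr2 -mulrA ler_wpM2l//.
  rewrite (_ : J%:R * (_ * _) = \sum_(0 <= i < J) (H / Num.sqrt m%:R * (K * M))); last first.
    by rewrite big_const_nat iter_addr addr0 subn0 mulr_natl.
  apply: ler_sum => i _; apply: (le_trans _ (c0le i)).
  rewrite ler_piMl//.
    apply: sumr_ge0 => j _; rewrite mulr_ge0 ?addr_ge0 ?sqr_ge0// mulr_ge0 ?addr_ge0 ?sqr_ge0//.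
  by rewrite exprn_ile1 ?exprn_ge0 ?exprn_ile1//; case/andP: r01.
(* Half of the lower bound for [S_J]; the other half absorbs [S_0]. *)
pose lam := M * (Num.sqrt (Y / A) / (16 * T)).
have YA0 : 0 < Y / A by rewrite divr_gt0.
have lam0 : 0 < lam by rewrite mulr_gt0// divr_gt0 ?sqrtr_gt0// mulr_gt0.
have L0 : 0 < pi *+ 2 / theta :> R by rewrite divr_gt0// pmulrn_lgt0 ?pi_gt0.
have cf : continuous f.
  move=> u; apply: cvgMr; apply: continuous_sum => i v.
  apply: cvgMr; apply: (@continuous_comp _ _ _ (al_ i) (fun y => y ^+ 2)); last exact: exprn_continuous.
  exact: continuous_alt_sum.
have f0 u : 0 <= f u.
  by rewrite mulr_ge0// sumr_ge0// => i _; rewrite mulr_ge0 ?sqr_ge0.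
have [E [mE muE hE]] := has_mean_markov _ _ c _ _ L0 A1 LA (exprn_gt0 2 lam0) cf f0 mf.
exists E; split => //.
- apply: (le_trans muE); rewrite lee_fin.
  (* The factor [theta] gained here cancels the length [2 pi / theta] of the period. *)
  have sm : T / theta <= Num.sqrt m%:R.
    rewrite -(@ler_pXn2r _ 2)// ?nnegrE ?sqrtr_ge0 ?divr_ge0 ?(ltW T0) ?(ltW t0)//.
    by rewrite sqr_sqrtr ?ler0n// expr_div_n ler_pdivrMr ?exprn_gt0.
  have sm0 : 0 < Num.sqrt m%:R :> R by rewrite sqrtr_gt0 ltr0n.
  have ism : (Num.sqrt m%:R)^-1 <= theta / T.
    by rewrite -(invf_div T) lef_pV2 ?posrE// divr_gt0.
  have cle2 : c <= J%:R ^+ 2 * (H * (theta / T) * (K * M)).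
    apply: (le_trans cle); rewrite ler_wpM2l ?sqr_ge0//.
    by rewrite ler_wpM2r ?ler_wpM2l// mulr_ge0// ltW.
  have lamE : lam ^+ 2 = M ^+ 2 * Y / (256 * A * T ^+ 2).
    rewrite /lam exprMn expr_div_n sqr_sqrtr ?(ltW YA0)//.
    by field; rewrite !gt_eqF.
  have pi4 : pi *+ 2 <= 8 :> R.
    by rewrite -mulr_natl; have := @pihalf_lt2 R; lra.
  have pi0 : 0 < pi *+ 2 :> R by rewrite pmulrn_lgt0 ?pi_gt0.
  rewrite lamE.
  apply: (@le_trans _ _ (A * (8 / theta) * (J%:R ^+ 2 * (H * (theta / T) * (K * M))) /
      (M ^+ 2 * Y / (256 * A * T ^+ 2)))).
    apply: ler_wpM2r; first by rewrite invr_ge0 -lamE sqr_ge0.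
    have a0 : 0 <= A * (pi *+ 2 / theta) by rewrite mulr_ge0 ?(ltW A0) ?(ltW L0).
    apply: (le_trans (ler_wpM2l a0 cle2)).
    apply: ler_wpM2r.
      by rewrite !mulr_ge0 ?sqr_ge0 ?invr_ge0 ?(ltW t0) ?(ltW T0) ?(ltW M0).
    by rewrite ler_pM2l ?ler_pM2r ?invr_gt0.
  rewrite le_eqVlt; apply/orP; left; apply/eqP; rewrite -/M.
  by field; rewrite !gt_eqF.
- move=> al /andP[al1 al2] hal; apply: hE; first by rewrite al1 al2.
  have al0 : 0 < al by apply: lt_le_trans al1; rewrite invr_gt0.
  have dpos k : k \in s -> 0 < d k.
    by move=> /hs[_ /andP[h _]]; lra.
  have er k : k \in s -> expR (ln al + rho k) = al * d k.
    by move=> ks; rewrite expRD !lnK ?posrE// dpos.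
  have lo : M * (Num.sqrt (Y / A) / (8 * T)) <= dilated_sum theta m N J s rho (ln al).
    apply: dilated_sum_ge => //; first exact: ltW.
    move=> k ks; rewrite er//; have [_ /andP[d1 d2]] := hs k ks.
    have ad : Y / A <= al * d k.
      by rewrite mulrC ler_pM// ?invr_ge0 ltW.
    split=> //.
    + apply: (@le_trans _ _ (Y / A * 2 ^+ J)); last by rewrite ler_pM2r ?exprn_gt0.
      by rewrite mulrAC ler_pdivlMr.
    + apply: (le_trans _ hN); have : al * d k <= A * (2 * Y).
        by rewrite ler_pM// ltW// dpos.
      lra.
  have up : dilated_sum theta m N 0 s rho (ln al) <= M * (N%:R * del).
    apply: dilated_sum0_le => k n ks nN.
    by have := hal k n ks nN; rewrite lnM ?posrE// dpos.
  have up2 : M * (N%:R * del) <= M * (Num.sqrt (Y / A) / (16 * T)) by rewrite ler_pM2l.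
  have := dilated_sum_telescope theta m N J s rho (ln al).
  set W := \sum_(0 <= i < J) _ => WE.
  have lW : lam <= W.
    rewrite -WE /lam.
    have e : M * (Num.sqrt (Y / A) / (8 * T)) = 2 * (M * (Num.sqrt (Y / A) / (16 * T))).
      by field; rewrite gt_eqF.
    lra.
  have : lam ^+ 2 <= W ^+ 2 by rewrite lerXn2r ?nnegrE//; lra.
  move=> /le_trans; apply.
  apply: le_trans (sqr_sum_le _ _) _; rewrite /f ler_wpM2l//.
  by apply: ler_sum => i _; rewrite exprMn.
Qed.

Lemma exp2_ge {R : realType} (X : R) : exists l0 : nat, forall l, (l0 <= l)%N -> X <= 2 ^+ l.
Proof.
exists (Num.bound X) => l hl; have [X0|X0] := leP 0 X; last first.
  by rewrite (le_trans (ltW X0))// exprn_ge0.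
apply: le_trans (ltW (archi_boundP X0)) _.
by rewrite -natrX ler_nat (leq_trans hl)// ltnW// ltn_expl.
Qed.

Lemma exp2_le_exp {R : realType} (n : nat) : 2 ^+ n <= expR n%:R :> R.
Proof.
rewrite -[n%:R]mulr1 expRM_natl lerXn2r ?nnegrE ?expR_ge0//.
by have := expR_ge1Dx (1 : R); lra.
Qed.

(** * Choice of the parameters at scale [z = 2 ^ l] *)

Section ScaleChoice.
Context {R : realType} (A c z Y psi : R) (q l : nat).
Hypotheses (A1 : 1 <= A) (c0 : 0 < c) (c1 : c <= 1).
Hypotheses (zE : z = 2 ^+ l) (zA : 16 * A / c <= z).
Hypotheses (cY : c <= Y) (Yz : Y <= z ^+ q) (psi0 : 0 < psi) (psi1 : psi <= 1)
  (psiz : 1 <= psi * z ^+ q).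
(** Exponents of [z]: [T <= z ^ a], [m <= z ^ b], and [z ^ e] is the power that the tail
    [exp (- z ^ 2 / 16)] has to beat. *)
Let a := (2 * q + 2)%N.
Let b := (2 * a + 3)%N.
Let e := (a + 2 * b + 3)%N.
Hypothesis (lz : (16 * e * l <= 2 ^ l)%N).

(** A distance [psi] from an integer forces a logarithmic distance [psi / (8A(Y + 1))]; the kernel
    is made narrower than this by the factor [z]. The [+ 1] keeps that distance at most [1 / 2] for
    small [Y]. *)
Let T := z * (8 * A * (Y + 1) / psi).
Let m := (Num.truncn (T ^+ 2 * z ^+ 2)).+1.
(** Here [N] is the range of the integers [n], not the length of the sequence. The exponent [2b]
    lets the eta polynomials reach the length required by [eta_partial_Lindelof] at frequencies up
    to [z ^ b]. *)
Let N := (16 * (2 ^ l) ^ (2 * b))%N.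
Let J := ((a + 2) * l)%N.
(** All logarithmic differences met are at most [2z] in absolute value, well inside the period
    [2 pi z]. *)
Let theta := z^-1.

Let A0 : 0 < A. Proof. exact: (lt_le_trans ltr01 A1). Qed.
Let Y0 : 0 < Y. Proof. exact: (lt_le_trans c0 cY). Qed.
Let zAc : 16 * A <= c * z. Proof. by rewrite [leRHS]mulrC -ler_pdivrMr. Qed.
Let z0 : 0 < z. Proof. by rewrite zE exprn_gt0. Qed.
Let zA' : 16 * A <= z. 
Proof. by apply: (le_trans zAc); rewrite ler_piMl// ltW. Qed.
Let z16 : 16 <= z. Proof. have := A1; have := zA'; lra. Qed.
Let z1 : 1 <= z. Proof. have := z16; lra. Qed.
Let zq (n : nat) : 1 <= z ^+ n. Proof. exact: exprn_ege1. Qed.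
Let zmono (n p : nat) : (n <= p)%N -> z ^+ n <= z ^+ p.
Proof. by move=> np; rewrite ler_eXn2l ?(lt_le_trans _ z16)// ltr1n. Qed.

Let NE : N%:R = 16 * z ^+ (2 * b) :> R.
Proof. by rewrite /N natrM !natrX -zE. Qed.

Lemma scale_bounds : [/\ z <= T, Y <= T & T <= z ^+ a].
Proof.
have i1 : 1 <= psi^-1 by rewrite invf_ge1.
have h1 : 8 * A * (Y + 1) <= 8 * A * (Y + 1) / psi.
  by rewrite ler_peMr// mulr_ge0; [|have := A0; lra|have := Y0; lra].
have h2 : Y + 1 <= 8 * A * (Y + 1).
  rewrite ler_peMl; [done|have := Y0; lra|have := A1; lra].
have zT : z * (Y + 1) <= T by rewrite /T ler_pM2l//; exact: le_trans h1.
split.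
- apply: le_trans zT; rewrite ler_peMr ?(ltW z0)//; have := Y0; lra.
- apply: le_trans zT; have := Y0 => y0.
  have : 1 * (Y + 1) <= z * (Y + 1) by apply: ler_wpM2r => //; lra.
  lra.
- have ps : psi^-1 <= z ^+ q by rewrite -[leLHS]mul1r ler_pdivrMr// mulrC.
  have Y2 : Y + 1 <= 2 * z ^+ q by have := zq q; have := Yz; lra.
  have aE : z ^+ a = z * (z * z ^+ q * z ^+ q).
    by rewrite /a addn2 !exprS mul2n -addnn exprD; ring.
  rewrite aE /T ler_pM2l//; apply: ler_pM => //.
  - by rewrite mulr_ge0; [|have := A0; lra|have := Y0; lra].
  - by rewrite invr_ge0 ltW.
  - apply: (@le_trans _ _ (8 * A * (2 * z ^+ q))).
      by rewrite ler_pM2l// mulr_gt0.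
    rewrite (_ : 8 * A * (2 * z ^+ q) = 16 * A * z ^+ q); last by ring.
    by apply: ler_wpM2r; [exact: le_trans (zq q)|exact: zA'].
Qed.

Let T0 : 0 < T.
Proof. by have [h _ _] := scale_bounds; exact: lt_le_trans h. Qed.

Lemma size_bounds : [/\ T ^+ 2 <= m%:R * theta ^+ 2, m%:R * theta ^+ 2 <= 2 * T ^+ 2
  & m%:R <= z ^+ b].
Proof.
have [zT _ Ta] := scale_bounds.
have x0 : 0 <= T ^+ 2 * z ^+ 2 by rewrite mulr_ge0 ?sqr_ge0.
have /andP[h1 h2] := truncn_itv x0.
have T1 : 1 <= T by exact: le_trans zT.
have x1 : 1 <= T ^+ 2 * z ^+ 2.
  by rewrite mulr_ege1// exprn_ege1.
have m2 : m%:R <= 2 * (T ^+ 2 * z ^+ 2) by rewrite /m -natr1; lra.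
have z20 : 0 < z ^+ 2 by rewrite exprn_gt0.
split.
- by rewrite /theta exprVn ler_pdivlMr// ltW.
- by rewrite /theta exprVn ler_pdivrMr// -mulrA.
- apply: (le_trans m2).
  have -> : z ^+ b = z * (z ^+ a ^+ 2 * z ^+ 2).
    by rewrite /b exprD [(2 * a)%N]mulnC exprM; move: (z ^+ a) => y; ring.
  apply: ler_pM => //; first by have := z16; lra.
  by rewrite ler_pM2r// lerXn2r ?nnegrE ?exprn_ge0 ?(ltW T0) ?(ltW z0).
Qed.

Lemma freq_bound (i j : nat) : (j <= m.*2)%N ->
  `|(m%:R - j%:R) * theta| <= z ^+ b /\ (1 + 3 * z ^+ b) ^+ 2 <= (2 ^ i * N)%N.+1%:R :> R.
Proof.
move=> jm; have [_ _ mb] := size_bounds; split.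
  have th1 : theta <= 1 by rewrite invf_le1.
  have th0 : 0 <= theta by rewrite invr_ge0 ltW.
  rewrite normrM (ger0_norm th0).
  apply: (@le_trans _ _ (m%:R * 1)); last by rewrite mulr1.
  apply: ler_pM => //.
  have : j%:R <= m.*2%:R :> R by rewrite ler_nat.
  rewrite -muln2 natrM => jm'; have := ler0n R j.
  by rewrite ler_norml; lra.
apply: (@le_trans _ _ (N%:R)); last first.
  by rewrite ler_nat leqW// leq_pmull// expn_gt0.
rewrite NE mulnC exprM; have := zq b; move: (z ^+ b) => x x1.
have : x <= x ^+ 2 by rewrite expr2 ler_peMr//; lra.
lra.
Qed.

Lemma window_bound : 2 * T * A <= Y * 2 ^+ J.
Proof.
have [_ _ Ta] := scale_bounds.
have -> : 2 ^+ J = z ^+ a * z ^+ 2 :> R by rewrite -exprD zE -exprM mulnC.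
apply: (@le_trans _ _ (c * (z ^+ a * z ^+ 2))); last first.
  by rewrite ler_pM2r// mulr_gt0// exprn_gt0.
have -> : c * (z ^+ a * z ^+ 2) = z ^+ a * ((c * z) * z) by ring.
have -> : 2 * T * A = T * (2 * A) by ring.
apply: ler_pM => //; rewrite ?(ltW T0) ?mulr_ge0 ?(ltW A0)//.
apply: (@le_trans _ _ (c * z * 1)); first by have := zAc; have := A1; lra.
by rewrite ler_pM2l// mulr_gt0.
Qed.

Lemma range_bound : 4 * A * Y <= N%:R.
Proof.
rewrite NE; apply: (@le_trans _ _ (z * z ^+ q)).
  apply: ler_pM; [have := A0; lra|exact: ltW|have := zA'; have := A1; lra|exact: Yz].
rewrite -exprS; apply: (@le_trans _ _ (z ^+ (2 * b))).
  by apply: zmono; rewrite /b /a; clear; lia.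
by rewrite ler_peMl ?exprn_ge0 ?(ltW z0) ?ler1n.
Qed.

(** By [lz], [16 * e * l <= z], so [z ^ e = 2 ^ (l * e) <= exp (l * e) <= exp (z ^ 2 / 16)]. *)
Lemma tail_bound : N%:R * expR (- (z ^+ 2 / 16)) <= Num.sqrt (Y / A) / (16 * T).
Proof.
have [_ _ Ta] := scale_bounds.
have sq : z^-1 <= Num.sqrt (Y / A).
  rewrite -(@ler_pXn2r _ 2)// ?nnegrE ?sqrtr_ge0 ?invr_ge0 ?(ltW z0)//.
  rewrite sqr_sqrtr ?divr_ge0 ?(ltW Y0) ?(ltW A0)// exprVn.
  rewrite -[leLHS]mul1r ler_pdivrMr ?exprn_gt0// mulrAC ler_pdivlMr// mul1r.
  apply: (@le_trans _ _ (c * z ^+ 2)); last by rewrite ler_pM2r ?exprn_gt0.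
  rewrite expr2 mulrA; apply: (@le_trans _ _ (c * z)); first by have := zAc; have := A1; lra.
  by rewrite ler_peMr// mulr_ge0// ltW.
have ex : z ^+ e <= expR (z ^+ 2 / 16).
  rewrite zE -exprM; apply: (le_trans (exp2_le_exp _)); rewrite ler_expR -zE.
  rewrite ler_pdivlMr// -natrM; apply: (@le_trans _ _ z); last first.
    by rewrite expr2 ler_peMr// ltW.
  by rewrite zE -natrX ler_nat; apply: leq_trans lz; rewrite [(l * e * 16)%N]mulnC mulnA mulnAC.
have T16 : 0 < 16 * T by rewrite pmulr_rgt0.
rewrite ler_pdivlMr//; apply: (le_trans _ sq).
rewrite expRN mulrAC ler_pdivrMr ?expR_gt0// [leRHS]mulrC ler_pdivlMr//.
apply: (le_trans _ ex); rewrite NE.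
have -> : z ^+ e = z * z ^+ (2 * b) * (z * z ^+ a) * z.
  by rewrite /e !exprD; move: (z ^+ a) (z ^+ (2 * b)) => x y; ring.
rewrite ler_pM2r//; apply: ler_pM.
- by rewrite mulr_ge0// exprn_ge0// ltW.
- by rewrite mulr_ge0// ltW.
- by apply: ler_wpM2r => //; rewrite exprn_ge0// ltW.
- by apply: ler_pM => //; exact: ltW.
Qed.

(** Every quantity is polynomial in [z], so its logarithm is [O(l)], which [z = 2 ^ l] dominates.
    This puts [ker_le_exp] within its range [theta * |x| <= 2]. *)
Lemma log_bound (al dk : R) (n : nat) : A^-1 <= al <= A -> Y <= dk <= 2 * Y -> (n < N)%N ->
  `|ln (al * dk) - ln n.+1%:R| <= 2 * z.
Proof.
move=> /andP[al1 al2] /andP[d1 d2] nN.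
have lnz : ln z <= l%:R.
  have := @exp2_le_exp R l; rewrite -zE => h.
  by rewrite -ler_expR lnK ?posrE.
have al0 : 0 < al by apply: lt_le_trans al1; rewrite invr_gt0.
have dk0 : 0 < dk by exact: lt_le_trans d1.
have lo : - ln z <= ln (al * dk).
  rewrite -lnV ?posrE// ler_ln ?posrE ?invr_gt0 ?mulr_gt0//.
  apply: (@le_trans _ _ (A^-1 * c)); last first.
    by apply: ler_pM; rewrite ?invr_ge0 ?(ltW A0) ?(ltW c0)//; exact: le_trans d1.
  rewrite mulrC ler_pdivlMr// mulrC ler_pdivrMr//.
  by have := zAc; have := A1; lra.
have hi : ln (al * dk) <= (q.+1 * l)%:R.
  apply: (@le_trans _ _ (ln (z ^+ q.+1))).
    rewrite ler_ln ?posrE ?mulr_gt0 ?exprn_gt0//.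
    apply: (@le_trans _ _ (A * (2 * Y))).
      by apply: ler_pM => //; exact: ltW.
    rewrite exprS mulrCA mulrA; apply: ler_pM => //; rewrite ?mulr_ge0 ?(ltW A0) ?(ltW Y0)//.
    by have := zA'; have := A1; lra.
  by rewrite lnXn// natrM -(mulr_natl (ln z)) ler_wpM2l.
have n0 : 0 <= ln n.+1%:R :> R by rewrite ln_ge0// ler1n.
have n1 : ln n.+1%:R <= ((2 * b).+1 * l)%:R :> R.
  apply: (@le_trans _ _ (ln (z ^+ (2 * b).+1))).
    rewrite ler_ln ?posrE ?ltr0n ?exprn_gt0//.
    apply: (@le_trans _ _ N%:R); first by rewrite ler_nat.
    by rewrite NE exprS; apply: ler_wpM2r; rewrite ?exprn_ge0// ltW.
  by rewrite lnXn// natrM -(mulr_natl (ln z)) ler_wpM2l.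
have tot : (q.+1 * l)%:R + l%:R + ((2 * b).+1 * l)%:R <= z :> R.
  rewrite -!natrD zE -natrX ler_nat; apply: leq_trans lz.
  rewrite /e /a -mulSnr -mulnDl leq_mul2r; apply/orP; right; rewrite /b /a; clear; lia.
have l0 : 0 <= l%:R :> R by [].
have q0 : 0 <= (q.+1 * l)%:R :> R by [].
rewrite ler_norml; apply/andP; split; lra.
Qed.

(** By [dist_le_ln], a distance at least [psi] forces [|x| >= z / T]; then [m * theta ^ 2 >= T ^ 2]
    turns the exponent of [ker_le_exp] into [z ^ 2 / 16]. *)
Lemma ker_far (al dk : R) (n : nat) : A^-1 <= al <= A -> Y <= dk <= 2 * Y -> (n < N)%N ->
  psi <= `|al * dk - n.+1%:R| ->
  ker theta m (ln (al * dk) - ln n.+1%:R) <= expR (- (z ^+ 2 / 16)).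
Proof.
move=> hal hd nN far.
have lb := log_bound al dk n hal hd nN.
move: hal hd => /andP[al1 al2] /andP[d1 d2].
have al0 : 0 < al by apply: lt_le_trans al1; rewrite invr_gt0.
have dk0 : 0 < dk by exact: lt_le_trans d1.
have n0 : 0 < n.+1%:R :> R by rewrite ltr0n.
have ad0 := mulr_gt0 al0 dk0.
set x := ln _ - _ in lb *.
have th0 : 0 < theta by rewrite invr_gt0.
have th2 : theta * `|x| <= 2 by rewrite mulrC ler_pdivrMr.
apply: (le_trans (ker_le_exp theta x m (ltW th0) th2)).
rewrite ler_expR lerN2 ler_pM2r ?invr_gt0//.
have [mT _ _] := size_bounds.
pose T' := 8 * A * (Y + 1) / psi.
have T'0 : 0 < T' by rewrite divr_gt0// mulr_gt0 ?mulr_gt0//; have := Y0; lra.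
have xT : T'^-1 <= `|x|.
  rewrite leNgt; apply/negP => xlt.
  have T'2 : T'^-1 <= 1 / 2.
    rewrite mul1r lef_pV2 ?posrE// /T' ler_pdivlMr//.
    apply: (@le_trans _ _ (2 * 1)); first by rewrite ler_pM2l.
    have : 1 * 1 <= A * (Y + 1) by apply: ler_pM => //; have := Y0; lra.
    lra.
  have := dist_le_ln _ _ ad0 n0 (le_trans (ltW xlt) T'2); rewrite -/x => h.
  have h2 : al * dk <= A * (2 * Y) by apply: ler_pM => //; exact: ltW.
  have h3 : 2 * (al * dk) * `|x| <= 2 * (A * (2 * Y)) * T'^-1.
    by apply: ler_pM; rewrite ?mulr_ge0 ?(ltW ad0) ?(ltW al0) ?(ltW dk0) ?(ltW xlt) ?ler_pM2l.
  have h4 : 2 * (A * (2 * Y)) * T'^-1 < psi.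
    rewrite ltr_pdivrMr//; have -> : psi * T' = 8 * A * (Y + 1) by rewrite /T'; field; rewrite gt_eqF.
    by have := mulr_gt0 A0 Y0; have := A0; lra.
  by have := le_trans far h; lra.
rewrite exprMn mulrA.
apply: (@le_trans _ _ (T ^+ 2 * x ^+ 2)); last by rewrite ler_wpM2r ?sqr_ge0.
have Tx0 : 0 <= T * `|x| := mulr_ge0 (ltW T0) (normr_ge0 x).
rewrite -(real_normK (num_real x)) -exprMn lerXn2r ?nnegrE ?(ltW z0)//.
by rewrite /T -/T' -mulrA ler_peMr ?(ltW z0)// mulrC -ler_pdivrMr// mul1r.
Qed.

(** The power [z ^ 4] collects [J ^ 2 <= z ^ 2], the bound [K * z] on eta, and the factor [z] in
    [T]. The ratio [(Y + 1) / Y] is at most [2 / c]. *)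
Lemma bad_set_bound (K : R) (s : seq nat) (d : nat -> R) : 0 <= K ->
  (forall (t : R) (M : nat), `|t| <= z ^+ b -> (1 + 3 * z ^+ b) ^+ 2 <= M.+1%:R ->
     eta_cos M t ^+ 2 + eta_sin M t ^+ 2 <= K * z) ->
  uniq s -> (0 < size s)%N ->
  (forall k, k \in s -> k%:R <= d k < k.+1%:R /\ Y <= d k <= 2 * Y) ->
  exists E : set R, [/\ measurable E,
    (lebesgue_measure E <=
      (2048 * (256 * 12) * A ^+ 2 * K * (16 * A / c) * z ^+ 4 / ((size s)%:R * psi))%:E)%E &
    forall al, A^-1 <= al <= A -> ~ E al ->
      exists2 k, k \in s & exists n : nat, `|al * d k - n%:R| < psi].
Proof.
move=> K0 hK us s0 hs.
have [zT YT Ta] := scale_bounds; have [mT1 mT2 _] := size_bounds.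
have z0' := ltW z0.
have th : 0 < theta <= 1 by rewrite invr_gt0 z0 invf_le1.
have LA : 2 * ln A <= pi *+ 2 / theta.
  rewrite /theta invrK.
  have : ln A <= z.
    by apply: (le_trans (ltW (ln_sublinear A0))); have := zA'; have := A1; lra.
  have : 2 * z <= pi *+ 2 * z.
    by apply: ler_wpM2r => //; rewrite -mulr_natl; have := @pi_ge2 R; lra.
  lra.
have T1 : 1 <= T by exact: le_trans zT.
have mT : T ^+ 2 <= m%:R * theta ^+ 2 <= 2 * T ^+ 2 by rewrite mT1 mT2.
have YT' : 0 < Y <= T by rewrite Y0 YT.
have hH i j : (j <= m.*2)%N ->
     eta_cos (2 ^ i * N) ((m%:R - j%:R) * theta) ^+ 2 +
     eta_sin (2 ^ i * N) ((m%:R - j%:R) * theta) ^+ 2 <= K * z.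
  by move=> jm; have [h1 h2] := freq_bound i j jm; exact: hK.
have [E [mE muE hE]] := bad_measure theta (K * z) T A Y _ m N J s d th A1 LA T1 mT YT'
  (mulr_ge0 K0 z0') us s0 hs hH window_bound range_bound tail_bound.
pose M : R := (size s)%:R.
have M0 : 0 < M by rewrite ltr0n.
exists E; split => //.
- apply: (le_trans muE); rewrite lee_fin -/M.
  have Jz : J%:R <= z.
    rewrite zE -natrX ler_nat; apply: leq_trans lz.
    rewrite /J leq_mul2r; apply/orP; right; rewrite /e; clear; lia.
  have J2 : J%:R ^+ 2 <= z ^+ 2 by rewrite lerXn2r ?nnegrE.
  have TY : T / (M * Y) <= z * (16 * A / c) / (M * psi).
    have -> : T / (M * Y) = z * (8 * A * ((Y + 1) / Y)) / (M * psi).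
      by rewrite /T; field; rewrite !gt_eqF.
    have w0 : 0 < (M * psi)^-1 by rewrite invr_gt0 pmulr_rgt0.
    rewrite ler_pM2r// ler_pM2l//.
    have -> : 16 * A / c = 8 * A * (2 / c) by field; rewrite gt_eqF.
    rewrite ler_pM2l ?mulr_gt0// ler_pdivrMr// mulrAC ler_pdivlMr//.
    have : c * Y <= 1 * Y by rewrite ler_pM2r.
    by have := cY; lra.
  move: (2048 * (256 * 12)) (mulr_ge0 (ler0n R 2048) (mulr_ge0 (ler0n R 256) (ler0n R 12))) => C0 C00.
  have -> : C0 * A ^+ 2 * J%:R ^+ 2 * (K * z) * T / (M * Y) =
    C0 * A ^+ 2 * K * z * (J%:R ^+ 2 * (T / (M * Y))).
    by field; rewrite !gt_eqF.
  have -> : C0 * A ^+ 2 * K * (16 * A / c) * z ^+ 4 / (M * psi) =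
    C0 * A ^+ 2 * K * z * (z ^+ 2 * (z * (16 * A / c) / (M * psi))).
    by field; rewrite !gt_eqF.
  have P0 : 0 <= C0 * A ^+ 2 * K * z by rewrite !mulr_ge0 ?sqr_ge0 ?(ltW A0).
  apply: (ler_wpM2l P0); apply: ler_pM => //.
  by rewrite divr_ge0 ?(ltW T0) ?mulr_ge0 ?(ltW M0) ?(ltW Y0).
- move=> al hal nE; apply: contrapT => hno; apply: nE; apply: hE => // k n ks nN.
  have [_ hk] := hs k ks.
  apply: (ker_far al (d k) n hal hk nN); rewrite leNgt; apply/negP => lt.
  by apply: hno; exists k => //; exists n.+1.
Qed.

End ScaleChoice.

(** * Differences and additive energy *)

Lemma sqr_sum_seq_le {R : realType} (I : Type) (s : seq I) (F : I -> R) :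
  (\sum_(i <- s) F i) ^+ 2 <= (size s)%:R * \sum_(i <- s) F i ^+ 2.
Proof.
case: s => [|i0 s0]; first by rewrite !big_nil expr0n mul0r.
set s := _ :: _; rewrite !(big_nth i0); exact: (sqr_sum_le _ (fun i => F (nth i0 s i))).
Qed.

Section Collisions.
Context {I : finType} (P : {set I}) (fl : I -> nat).
Let s := undup [seq fl p | p <- enum P].
Let r k := (\sum_(p in P) (fl p == k))%N.

Let fl_s p : p \in P -> fl p \in s.
Proof. by move=> pP; rewrite mem_undup map_f// mem_enum. Qed.

Let indicator_sum p : p \in P -> (\sum_(k <- s) (fl p == k) = 1)%N.
Proof.
move=> pP; rewrite -big_mkcond sum1_count.
have /= -> := eq_count (a2 := pred1 (fl p)); last by move=> k; rewrite /= eq_sym.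
by rewrite count_uniq_mem ?undup_uniq// fl_s.
Qed.

Lemma fiber_sum : (\sum_(k <- s) r k = #|P|)%N.
Proof.
rewrite /r exchange_big/= -sum1_card; apply: eq_bigr => p; exact: indicator_sum.
Qed.

Lemma fiber_sqr_sum : (\sum_(k <- s) r k ^ 2 =
  #|[set pq : I * I | [&& pq.1 \in P, pq.2 \in P & fl pq.1 == fl pq.2]]%SET|)%N.
Proof.
transitivity (\sum_(p in P) \sum_(q in P) (fl p == fl q))%N.
  transitivity (\sum_(k <- s) \sum_(p in P) \sum_(q in P) (fl p == k) * (fl q == k))%N.
    by apply: eq_bigr => k _; rewrite -mulnn /r big_distrlr.
  rewrite exchange_big/=; apply: eq_bigr => p pP.
  rewrite exchange_big/=; apply: eq_bigr => q qP.
  transitivity (\sum_(k <- s) (fl p == fl q) * (fl p == k))%N.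
    apply: eq_bigr => k _; have [->|pk] := eqVneq (fl p) k; last by rewrite muln0.
    by rewrite mul1n muln1 eq_sym.
  by rewrite -big_distrr/= indicator_sum// muln1.
rewrite pair_big_dep/= -sum1_card [RHS]big_mkcond/= [LHS]big_mkcond/=.
apply: eq_bigr => -[p q] _; rewrite finset.in_set/=.
by case: (p \in P); case: (q \in P); case: (_ == _).
Qed.

(** Cauchy-Schwarz over the fibres of [fl]: few collisions force many distinct values. *)
Lemma fiber_count {R : realType} :
  (#|P|%:R : R) ^+ 2 <= (size s)%:R *
    (#|[set pq : I * I | [&& pq.1 \in P, pq.2 \in P & fl pq.1 == fl pq.2]]%SET|)%:R.
Proof.
rewrite -fiber_sum -fiber_sqr_sum !natr_sum.
apply: le_trans (sqr_sum_seq_le _ _ _) _; rewrite ler_wpM2l//.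
by apply: ler_sum => k _; rewrite natrX.
Qed.

End Collisions.

Lemma gap_mono {R : realType} (x : nat -> R) (c : R) (i j : nat) : 0 <= c ->
  (forall n : nat, (1 <= n)%N -> c <= x n.+1 - x n) -> (1 <= i)%N -> (i <= j)%N -> x i <= x j.
Proof.
move=> c0 hc i1; elim: j => [|j IH]; first by rewrite leqn0 => /eqP->.
rewrite leq_eqVlt => /predU1P[->//|]; rewrite ltnS => ij.
by have := IH ij; have := hc j (leq_trans i1 ij); lra.
Qed.

Lemma card_lt_pairs N : (#|[set p : 'I_N * 'I_N | (p.1 < p.2)%N]%SET|.*2 + N = N * N)%N.
Proof.
have -> : #|[set p : 'I_N * 'I_N | (p.1 < p.2)%N]%SET| = (\sum_(i < N) \sum_(j < N) (i < j))%N.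
  rewrite pair_big/= -sum1_card big_mkcond/=; apply: eq_bigr => -[i j] _.
  by rewrite finset.in_set/=; case: (_ < _)%N.
have diag : (\sum_(i < N) \sum_(j < N) (i == j) = N)%N.
  rewrite -[RHS](card_ord N) -sum1_card; apply: eq_bigr => i _.
  by rewrite -big_mkcond/= (big_pred1 i)// => j; rewrite /= eq_sym.
transitivity (\sum_(i < N) \sum_(j < N) ((i < j) + (j < i) + (i == j)))%N; last first.
  transitivity (\sum_(i < N) \sum_(j < N) 1)%N.
    apply: eq_bigr => i _; apply: eq_bigr => j _; rewrite -val_eqE/=.
    by case: ltngtP.
  by under eq_bigr do rewrite sum1_card card_ord; rewrite sum_nat_const card_ord.
under [RHS]eq_bigr do rewrite !big_split/=.
rewrite !big_split/= diag; congr (_ + _)%N.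
by rewrite [X in (_ + X)%N]exchange_big/= addnn.
Qed.

Section Differences.
Context {R : realType} (x : nat -> R) (c : R) (N S : nat).
Hypotheses (c0 : 0 < c) (hc : forall n : nat, (1 <= n)%N -> c <= x n.+1 - x n).
Hypotheses (x0 : forall n : nat, (1 <= n)%N -> 0 < x n) (xS : x N < c * 2 ^+ S).
Hypothesis N2 : (2 <= N)%N.

Let df (p : 'I_N * 'I_N) : R := x p.2.+1 - x p.1.+1.
Let cls (t : nat) : {set 'I_N * 'I_N} :=
  [set p : 'I_N * 'I_N | (p.1 < p.2)%N && (c * 2 ^+ t <= df p < c * 2 ^+ t.+1)]%SET.

Let df_bounds (p : 'I_N * 'I_N) : (p.1 < p.2)%N -> c <= df p < c * 2 ^+ S.
Proof.
move=> p12; have h1 : x p.1.+2 <= x p.2.+1 by exact: (gap_mono x c _ _ (ltW c0) hc).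
have h2 := hc p.1.+1 isT.
have h3 : x p.2.+1 <= x N by apply: (gap_mono x c _ _ (ltW c0) hc).
have h4 := x0 p.1.+1 isT.
have := xS; rewrite /df; move: (c * 2 ^+ S) => B xB.
by apply/andP; split; lra.
Qed.

Let cls_cover (p : 'I_N * 'I_N) : (p.1 < p.2)%N -> exists2 t, (t < S)%N & p \in cls t.
Proof.
move=> p12; have /andP[h1 h2] := df_bounds p p12.
have [t tS ht] : exists2 t, (t < S)%N & c * 2 ^+ t <= df p < c * 2 ^+ t.+1.
  elim: S h2 => [|S' IH] h2; first by have := le_lt_trans h1 h2; rewrite expr0 mulr1 ltxx.
  have [h|h] := ltP (df p) (c * 2 ^+ S').
    by have [t tS ht] := IH h; exists t => //; rewrite ltnW.
  by exists S' => //; rewrite h h2.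
by exists t => //; rewrite finset.in_set p12.
Qed.

(** For [N >= 2] at least [N ^ 2 / 4] pairs have [p.1 < p.2], and they spread over [S] dyadic
    classes. *)
Let pigeonhole : exists2 t, (t < S)%N & (N * N <= 4 * S * #|cls t|)%N.
Proof.
have cov : (#|[set p : 'I_N * 'I_N | (p.1 < p.2)%N]%SET| <= \sum_(t < S) #|cls t|)%N.
  apply: (@leq_trans (\sum_p \sum_(t < S) (p \in cls t))%N).
    rewrite -sum1_card big_mkcond/=; apply: leq_sum => p _; case: ifP => //.
    rewrite finset.in_set => /cls_cover[t tS pt].
    by rewrite (bigD1 (Ordinal tS))//= pt.
  rewrite exchange_big/=; apply: leq_sum => t _.
  by rewrite -sum1_card [leqRHS]big_mkcond.
have lt := card_lt_pairs N.
have NN : (N * N <= 4 * #|[set p : 'I_N * 'I_N | (p.1 < p.2)%N]%SET|)%N by nia.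
have S0 : (0 < S)%N.
  rewrite lt0n; apply/negP => /eqP S0; move: cov; rewrite S0 big_ord0; nia.
have [t ht] : exists t : 'I_S, (\sum_(t < S) #|cls t| <= S * #|cls t|)%N.
  have [t ht] := @bigop.eq_bigmax _ (fun t : 'I_S => #|cls t|) ltac:(by rewrite card_ord).
  exists t; have -> : (S * #|cls t| = \sum_(i < S) #|cls t|)%N by rewrite sum_nat_const card_ord.
  apply: leq_sum => i _.
  rewrite -ht; exact: (@bigop.leq_bigmax _ (fun t : 'I_S => #|cls t|) i).
exists t => //; nia.
Qed.

(** Differences with equal integer parts are less than 1 apart; regrouping
    [(x_b - x_a) - (x_b' - x_a')] as [x_b + x_a' - x_a - x_b'] yields a quadruple of the energy,
    injectively. *)
Let collisions_le (t : nat) :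
  (#|[set pq : ('I_N * 'I_N) * ('I_N * 'I_N) | [&& pq.1 \in cls t, pq.2 \in cls t &
      Num.truncn (df pq.1) == Num.truncn (df pq.2)]]%SET| <= energy x N)%N.
Proof.
pose g (pq : ('I_N * 'I_N) * ('I_N * 'I_N)) : 'I_N * 'I_N * 'I_N * 'I_N :=
  (pq.1.2, pq.2.1, pq.1.1, pq.2.2).
have gI : injective g by move=> [[a b] [a' b']] [[d e] [d' e']] [-> -> -> ->].
rewrite -(card_imset _ gI) /energy; apply: subset_leq_card; apply/fintype.subsetP => _ /imsetP[[[a b] [a' b']] + ->].
rewrite !finset.in_set /g/= => /and3P[/andP[ab /andP[h1 _]] /andP[ab' /andP[h1' _]] /eqP e].
have d0 : 0 <= df (a, b) by apply: le_trans h1; rewrite mulr_ge0 ?exprn_ge0 ?(ltW c0).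
have d0' : 0 <= df (a', b') by apply: le_trans h1'; rewrite mulr_ge0 ?exprn_ge0 ?(ltW c0).
have /andP[t1 t2] := truncn_itv d0; have /andP[t1' t2'] := truncn_itv d0'.
rewrite e -natr1 in t1 t2; rewrite -natr1 in t2'.
move: t1 t2 t1' t2'; rewrite /df/= => t1 t2 t1' t2'.
by rewrite inE/= ltr_norml; apply/andP; split; lra.
Qed.

Lemma energy_differences : exists t (s : seq nat) (d : nat -> R),
  [/\ uniq s, (0 < size s)%N, (t < S)%N,
   forall k, k \in s -> [/\ k%:R <= d k < k.+1%:R, c * 2 ^+ t <= d k <= 2 * (c * 2 ^+ t) &
     exists i j : nat, [/\ (1 <= i <= N)%N, (1 <= j <= N)%N, i != j & d k = x j - x i]] &
   N%:R ^+ 4 <= 16 * S%:R ^+ 2 * (size s)%:R * (energy x N)%:R :> R].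
Proof.
have [t tS hN] := pigeonhole.
pose fl p := Num.truncn (df p).
pose s := undup [seq fl p | p <- enum (cls t)].
have wit k : k \in s -> exists p, p \in cls t /\ fl p = k.
  rewrite mem_undup => /mapP[p]; rewrite mem_enum => pc ->; by exists p.
(* One pair is chosen for each integer part [k] that occurs, so that [d] can be indexed by the
   integer parts themselves. *)
have [w hw] : exists w : nat -> 'I_N * 'I_N, forall k, k \in s -> w k \in cls t /\ fl (w k) = k.
  have p0 : 'I_N * 'I_N by have i0 : 'I_N := Ordinal N2; exact: (i0, i0).
  have [w hw] : {w : nat -> 'I_N * 'I_N & forall k, k \in s -> w k \in cls t /\ fl (w k) = k}.
    apply: (@choice _ _ (fun k p => k \in s -> p \in cls t /\ fl p = k)) => k.
    have [ks|ks] := boolP (k \in s); last by exists p0.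
    by have [p hp] := wit k ks; exists p.
  by exists w.
have cnt := @fiber_count _ (cls t) fl R.
have E := collisions_le t.
have P0 : (0 < #|cls t|)%N by nia.
exists t, s, (fun k => df (w k)); split => //.
- exact: undup_uniq.
- have [p pP] := card_gt0P P0.
  have : fl p \in s by rewrite mem_undup map_f// mem_enum.
  by case: (s).
- move=> k /hw[]; rewrite finset.in_set => /andP[w12 /andP[h1 h2]] wk.
  have d0 : 0 <= df (w k) by apply: le_trans h1; rewrite mulr_ge0 ?exprn_ge0 ?(ltW c0).
  split.
  + by have := truncn_itv d0; rewrite -/(fl (w k)) wk.
  + by rewrite h1 ltW//= mulrCA -exprS.
  + exists (w k).1.+1, (w k).2.+1; split => //; first by rewrite /= ltn_ord.
      by rewrite /= ltn_ord.
    by rewrite eqSS neq_ltn w12.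
- have h : N%:R ^+ 2 <= 4 * S%:R * #|cls t|%:R :> R.
    by rewrite -natrX -!natrM ler_nat; apply: leq_trans hN; rewrite mulnn.
  have -> : N%:R ^+ 4 = (N%:R ^+ 2) ^+ 2 :> R by rewrite -exprM.
  apply: (@le_trans _ _ ((4 * S%:R * #|cls t|%:R) ^+ 2)).
    by rewrite lerXn2r ?nnegrE ?sqr_ge0// !mulr_ge0.
  have -> : (4 * S%:R * #|cls t|%:R) ^+ 2 = 16 * S%:R ^+ 2 * #|cls t|%:R ^+ 2 :> R by ring.
  rewrite -(mulrA (16 * _)); apply: ler_wpM2l; first by rewrite mulr_ge0 ?sqr_ge0.
  apply: (le_trans cnt); apply: ler_wpM2l => //.
  by rewrite ler_nat.
Qed.

End Differences.

(** * From one scale to almost every point *)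

(** Uniqueness of Lebesgue measure applied to the image under negation. It transfers null sets of
    [|alpha|] to negative [alpha]. *)
Lemma lebesgue_measure_opp {R : realType} (E : set R) : measurable E ->
  measurable (-%R @^-1` E) /\ lebesgue_measure (-%R @^-1` E) = lebesgue_measure E.
Proof.
move=> mE.
have mo : measurable_fun [set: measurableTypeR R] (-%R : R -> measurableTypeR R).
  exact: oppr_measurable.
split; first by rewrite -[X in measurable X]setTI; exact: mo.
apply/esym; apply: (@lebesgue_measure_unique R
  (measure_function_pushforward__canonical__measure_function_Measure lebesgue_measure mo)) => //.
move=> _ [[a b] _ <-]; rewrite /= /pushforward.
have -> : -%R @^-1` `]a, b] = `[- b, - a[%classic :> set R.
  by apply/seteqP; split => y /=; rewrite !in_itv/= => /andP[h1 h2]; apply/andP; split; lra.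
rewrite !lebesgue_measure_itv/= !lte_fin ltrN2; case: ifP => // _.
by rewrite -!EFinB; congr EFin; ring.
Qed.

Lemma borel_cantelli_geometric {R : realType} (F : nat -> set R) (C : R) :
  (forall k, measurable (F k)) ->
  (forall k, (lebesgue_measure (F k) <= (C / 2 ^+ k)%:E)%E) ->
  lebesgue_measure (lim_sup_set F) = 0%E.
Proof.
move=> mF hF; apply: lim_sup_set_cvg0 => //.
have C0 : 0 <= C.
  by have := le_trans (measure_ge0 _ _) (hF 0%N); rewrite expr0 divr1 lee_fin.
apply: (@le_lt_trans _ _ (2 * C)%:E); last exact: ltry.
apply: lime_le; first by apply: is_cvg_nneseries.
apply: nearW => n.
apply: (@le_trans _ _ (\sum_(0 <= k < n) (C / 2 ^+ k)%:E)%E); first by apply: lee_sum => k _; exact: hF.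
rewrite sumEFin lee_fin.
have -> : \sum_(0 <= k < n) C / 2 ^+ k = 2 * C - 2 * C / 2 ^+ n.
  elim: n => [|n IH]; first by rewrite big_geq// expr0 divr1 subrr.
  by rewrite big_nat_recr//= IH exprS; field; rewrite expf_neq0.
by rewrite gerBl divr_ge0 ?exprn_ge0// mulr_ge0.
Qed.

(* [2 ^ (p * l)] with [l] running through the integers catches every [N] up to
   the bounded factor [2 ^ p], which the [N ^ eps] absorbs. *)
Lemma dyadic_to_all {R : realType} (del : nat -> R) (g : R) :
  (forall N N' : nat, (2 <= N)%N -> (N <= N')%N -> del N' <= del N) ->
  (forall p : nat, (0 < p)%N -> exists l0 : nat, forall l, (l0 <= l)%N ->
     del (2 ^ (p * l))%N < 2 ^+ (10 * l) * ((2 ^ (p * l))%N%:R) `^ (- g)) ->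
  forall eps : R, 0 < eps -> exists N0 : nat, forall N : nat, (N0 <= N)%N ->
     del N < N%:R `^ (- g + eps).
Proof.
move=> dm hp eps e0.
(* Of the 11, ten account for [2 ^+ (10 * l) <= N ^ (10 / p)] and one for [G <= N ^ (1 / p)]. *)
pose p := (Num.bound (11 / eps)).+1.
have pe : 11 / p%:R <= eps.
  rewrite ler_pdivrMr ?ltr0n// mulrC -ler_pdivrMr//.
  apply: (le_trans (ltW (archi_boundP _))); first by rewrite divr_ge0// ltW.
  by rewrite ler_nat leqnSn.
have [l0 hl0] := hp p isT.
(* [G] bounds the change of [N ^ (- g)] under a factor at most [2 ^ p], for either sign of [g]. *)
pose G : R := (2 ^+ p) `^ `|g|.
have G0 : 0 < G by rewrite powR_gt0// exprn_gt0.
pose N1 := (Num.bound (G ^+ p)).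
exists (maxn (2 ^ (p * l0.+1)) N1) => N; rewrite geq_max => /andP[hN1 hN2].
pose l := trunc_log (2 ^ p) N.
have p2 : (1 < 2 ^ p)%N by rewrite -[X in (X < _)%N](expn0 2) ltn_exp2l.
have N0 : (0 < N)%N by apply: leq_trans hN1; rewrite expn_gt0.
have /andP[lN Nl] := trunc_log_bounds p2 N0.
rewrite -/l -!expnM in lN Nl.
have l0l : (l0.+1 <= l)%N.
  by apply: trunc_log_max => //; rewrite -expnM.
have NR0 : 0 < N%:R :> R by rewrite ltr0n.
have NR1 : 1 <= N%:R :> R by rewrite ler1n.
set N' := (2 ^ (p * l))%N in lN.
have N'2 : (2 <= N')%N.
  by rewrite /N' -[X in (X <= _)%N](expn1 2) leq_exp2l//; lia.
have N'0 : 0 < N'%:R :> R by rewrite ltr0n; lia.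
apply: le_lt_trans (dm N' N N'2 lN) _.
apply: (lt_le_trans (hl0 l (ltnW l0l))); rewrite -/N'.
have h1 : 2 ^+ (10 * l) <= N%:R `^ (10 / p%:R) :> R.
  apply: (@le_trans _ _ (N'%:R `^ (10 / p%:R))); last first.
    by apply: ge0_ler_powR; rewrite ?nnegrE ?ler_nat// divr_ge0.
  have -> : N'%:R = 2 `^ (p * l)%N%:R :> R by rewrite powR_mulrn// /N' natrX.
  rewrite -powRrM -powR_mulrn//.
  have -> : (p * l)%N%:R * (10 / p%:R) = (10 * l)%N%:R :> R.
    by rewrite !natrM; field; rewrite pnatr_eq0.
  by [].
have h2 : N'%:R `^ (- g) <= N%:R `^ (- g) * G.
  have [g0|g0] := leP 0 g.
    have NN : N%:R <= N'%:R * 2 ^+ p :> R.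
      rewrite -natrX -natrM ler_nat; apply: ltnW; apply: leq_trans Nl _.
      by rewrite /N' -expnD mulnSr.
    rewrite !powRN /G ger0_norm// mulrC ler_pdivlMr ?powR_gt0//.
    rewrite mulrC ler_pdivrMr ?powR_gt0// mulrC -powRM ?ler0n ?exprn_ge0//.
    apply: (ge0_ler_powR g0 _ _ NN); first by rewrite nnegrE ltW.
    by rewrite nnegrE ltW// (lt_le_trans NR0).
  apply: (@le_trans _ _ (N%:R `^ (- g))).
    by apply: ge0_ler_powR; rewrite ?nnegrE ?ler_nat//; lra.
  rewrite ler_peMr ?powR_ge0// /G -[leLHS](powRr0 (2 ^+ p)); apply: ler_powR => //.
  by rewrite exprn_ege1// ler1n.
have h3 : G <= N%:R `^ (p%:R^-1).
  have -> : G = (G ^+ p) `^ (p%:R^-1).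
    by rewrite -powR_mulrn ?(ltW G0)// -powRrM divff ?pnatr_eq0// powRr1// ltW.
  apply: ge0_ler_powR; rewrite ?nnegrE ?exprn_ge0 ?invr_ge0 ?(ltW G0)//.
  apply: (le_trans (ltW (archi_boundP _))); first by rewrite exprn_ge0// ltW.
  by rewrite ler_nat.
apply: (@le_trans _ _ (N%:R `^ (10 / p%:R) * (N%:R `^ (- g) * N%:R `^ (p%:R^-1)))).
  apply: ler_pM => //; rewrite ?exprn_ge0 ?powR_ge0//.
  by apply: (le_trans h2); rewrite ler_wpM2l ?powR_ge0.
rewrite -!powRD ?(gt_eqF NR0) ?implybT//; apply: ler_powR => //.
have : 10 / p%:R + p%:R^-1 = 11 / p%:R :> R by field; rewrite pnatr_eq0.
lra.
Qed.

Lemma exponent_correction {R : realType} (del : nat -> R) (g : R) :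
  (forall N : nat, (2 <= N)%N -> 0 <= del N) ->
  (forall eps : R, 0 < eps -> exists N0 : nat, forall N : nat, (N0 <= N)%N ->
     del N < N%:R `^ (- g + eps)) ->
  exists f : nat -> R, f @ \oo --> (0 : R) /\
    exists N0 : nat, forall N : nat, (N0 <= N)%N -> del N < N%:R `^ (- (g - f N)).
Proof.
move=> d0 hd.
(* The least nonnegative correction of the exponent when [del N > 0], and 0 otherwise, where the
   logarithm carries no information. The added [N.+1%:R^-1] makes the inequality strict. *)
pose h N := if 0 < del N then Num.max 0 (g + ln (del N) / ln N%:R) else 0.
exists (fun N => h N + N.+1%:R^-1).
have h0 N : 0 <= h N by rewrite /h; case: ifP => // _; rewrite le_max lexx.
have i0 N : 0 < N.+1%:R^-1 :> R by rewrite invr_gt0 ltr0n.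
have lnN N : (2 <= N)%N -> 0 < ln N%:R :> R by move=> N2; rewrite ln_gt0// ltr1n.
split.
- apply/cvgrPdist_lt => eps e0.
  have e2 : 0 < eps / 2 by rewrite divr_gt0.
  have [N0 hN0] := hd _ e2.
  pose N1 := Num.bound (2 / eps).
  exists (maxn 2 (maxn N0 N1)) => // N /=; rewrite !geq_max => /and3P[N2 hN hN1].
  rewrite sub0r normrN ger0_norm; last by rewrite addr_ge0// ltW.
  have a1 : N.+1%:R^-1 < eps / 2.
    rewrite -[eps / 2]invf_div ltf_pV2 ?posrE ?ltr0n ?divr_gt0//.
    apply: (lt_le_trans (archi_boundP _)); first by rewrite divr_ge0// ltW.
    by rewrite ler_nat (leq_trans hN1).
  have a2 : h N < eps / 2.
    rewrite /h; case: ifP => // dN; rewrite gt_max e2/=.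
    have := hN0 N hN; rewrite -ltr_ln ?posrE ?powR_gt0 ?ltr0n//; last by lia.
    rewrite ln_powR => lt.
    have : ln (del N) / ln N%:R < - g + eps / 2 by rewrite ltr_pdivrMr// lnN.
    lra.
  by rewrite [ltRHS]splitr ltrD.
- exists 2%N => N N2; have NR0 : 0 < N%:R :> R by rewrite ltr0n; lia.
  have [dN|dN] := ltP 0 (del N); last by apply: (le_lt_trans dN); rewrite powR_gt0.
  rewrite -ltr_ln ?posrE ?powR_gt0// ln_powR.
  have : g + ln (del N) / ln N%:R <= h N by rewrite /h dN le_max lexx orbT.
  move=> hh; have {}hh : ln (del N) / ln N%:R < - (g - (h N + N.+1%:R^-1)).
    by move: (i0 N); move: (N.+1%:R^-1) => w w0; lra.
  by rewrite -ltr_pdivrMr ?lnN.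
Qed.

(** * Elementary properties of the minimal gap *)

Section DeltaMin.
Context {R : realType} (x : nat -> R).

Lemma dist_int_ge0 (y : R) : 0 <= dist_int y.
Proof. by apply: lb_le_inf; [exists `|y - 0%:~R|, 0|move=> _ [k _ <-]]. Qed.

Lemma dist_int_le (y : R) (k : int) : dist_int y <= `|y - k%:~R|.
Proof. by apply: ge_inf; [exists 0 => _ [j _ <-]|exists k]. Qed.

Lemma delta_min_le (al : R) (N i j : nat) : (1 <= i <= N)%N -> (1 <= j <= N)%N -> i != j ->
  delta_min x al N <= dist_int (al * x i - al * x j).
Proof.
move=> hi hj ij; apply: ge_inf; last by exists (i, j).
by exists 0 => _ [mn _ <-]; exact: dist_int_ge0.
Qed.

Lemma delta_min_ge0 (al : R) (N : nat) : (2 <= N)%N -> 0 <= delta_min x al N.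
Proof.
move=> N2; apply: lb_le_inf; last by move=> _ [mn _ <-]; exact: dist_int_ge0.
by exists (dist_int (al * x 1%N - al * x 2%N)), (1%N, 2%N) => //; split => //=; lia.
Qed.

(** Below [N = 2] the infimum is over the empty set and takes the default value 0, hence the bound
    [2 <= N]. *)
Lemma delta_min_mono (al : R) (N N' : nat) : (2 <= N)%N -> (N <= N')%N ->
  delta_min x al N' <= delta_min x al N.
Proof.
move=> N2 NN; apply: lb_le_inf.
  by exists (dist_int (al * x 1%N - al * x 2%N)), (1%N, 2%N) => //; split => //=; lia.
move=> _ [[i j] /= [hi hj ij] <-]; apply: delta_min_le => //; lia.
Qed.

End DeltaMin.

Lemma uniq_size_le (s : seq nat) (B : nat) : uniq s -> (forall k, k \in s -> (k < B)%N) ->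
  (size s <= B)%N.
Proof.
move=> us sB; rewrite -[leqRHS](size_iota 0); apply: uniq_leq_size => // k ks.
by rewrite mem_iota /= add0n sB.
Qed.

(** * Exceptional sets along [N = 2 ^ (p * l)] *)

Section LevelSets.
Context {R : realType} (x : nat -> R) (beta c : R).
Hypothesis LH : Lindelof_hypothesis R.
Hypotheses (c0 : 0 < c) (c1 : c <= 1).
Hypothesis x0 : forall n : nat, (1 <= n)%N -> 0 < x n.
Hypothesis hc : forall n : nat, (1 <= n)%N -> c <= x n.+1 - x n.
Hypothesis growth : exists C K : R, forall n : nat, (1 <= n)%N -> x n <= K * (n%:R) `^ C.
Hypothesis henergy : forall eps : R, 0 < eps -> exists K : R,
  forall N : nat, (1 <= N)%N -> (energy x N)%:R <= K * (N%:R) `^ (beta + eps).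

Lemma growth_nat (p : nat) : exists kap l0 : nat, forall l, (l0 <= l)%N ->
  x (2 ^ (p * l))%N < c * 2 ^+ (kap * l).
Proof.
have [C [K hK]] := growth.
pose C0 := (Num.bound `|C|).
have CC0 : C <= C0%:R.
  by apply: le_trans (ler_norm _) _; rewrite ltW// archi_boundP.
have [l0 hl0] := exp2_ge (`|K| / c + 1).
(* [N ^ C0] is [z ^ (p * C0)] with [z = 2 ^ l]; one more factor [z] absorbs [|K| / c]. *)
exists (p * C0).+1, l0 => l hl.
set N := (2 ^ (p * l))%N.
have N1 : (1 <= N)%N by rewrite expn_gt0.
apply: le_lt_trans (hK N N1) _.
apply: (@le_lt_trans _ _ (`|K| * N%:R ^+ C0)).
  apply: (@le_trans _ _ (`|K| * N%:R `^ C)).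
    by rewrite ler_wpM2r ?powR_ge0 ?ler_norm.
  rewrite ler_wpM2l// -powR_mulrn ?ler0n//; apply: ler_powR => //.
  by rewrite ler1n.
have -> : N%:R ^+ C0 = 2 ^+ (p * C0 * l) :> R.
  by rewrite /N natrX -exprM; congr (_ ^+ _); rewrite mulnAC.
rewrite mulSn exprD mulrA ltr_pM2r ?exprn_gt0//.
have := hl0 l hl; have : `|K| = c * (`|K| / c) by field; rewrite gt_eqF.
move: (`|K| / c) (2 ^+ l : R) => y w -> yw.
by rewrite ltr_pM2l//; lra.
Qed.

(** The energy bound is used with [eps = 1 / p], for which [N ^ eps = z]. The factor [z ^ 4] absorbs
    this [z], the squared number of dyadic classes (at most [z ^ 2]), and the constant
    [16 * |Ke| <= z]. *)
Lemma differences_at_level (p : nat) : (0 < p)%N -> exists kap l0 : nat, forall l, (l0 <= l)%N ->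
  let N := (2 ^ (p * l))%N in let z : R := 2 ^+ l in
  exists (Y : R) (s : seq nat) (d : nat -> R),
  [/\ uniq s, (0 < size s)%N, c <= Y <= z ^+ kap,
   forall k, k \in s -> [/\ k%:R <= d k < k.+1%:R, Y <= d k <= 2 * Y &
     exists i j : nat, [/\ (1 <= i <= N)%N, (1 <= j <= N)%N, i != j & d k = x j - x i]] &
   N%:R ^+ 4 <= (size s)%:R * z ^+ 4 * N%:R `^ beta].
Proof.
move=> p0; have [kap [l1 hl1]] := growth_nat p.
have ip0 : 0 < p%:R^-1 :> R by rewrite invr_gt0 ltr0n.
have [Ke hKe] := henergy _ ip0.
have [l2 hl2] := mul_le_exp2 kap.
have [l3 hl3] := exp2_ge (16 * `|Ke|).
exists kap, (maxn 1 (maxn l1 (maxn l2 l3))) => l.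
rewrite !geq_max => /and4P[l_gt0 hll1 hll2 hll3] N z.
have N2 : (2 <= N)%N by rewrite /N -[X in (X <= _)%N](expn1 2) leq_exp2l// muln_gt0 p0.
have z1 : 1 <= z by rewrite exprn_ege1// ler1n.
have z0 : 0 < z by rewrite exprn_gt0.
have [t [s [d [us s0 tS hs hN]]]] := energy_differences x c N (kap * l) c0 hc x0 (hl1 l hll1) N2.
have zk : z ^+ kap = 2 ^+ (kap * l) by rewrite -exprM mulnC.
exists (c * 2 ^+ t), s, d; split => //.
  apply/andP; split; first by rewrite ler_peMr ?(ltW c0)// exprn_ege1// ler1n.
  rewrite zk; apply: (@le_trans _ _ (1 * 2 ^+ t)); first by rewrite ler_pM2r ?exprn_gt0.
  by rewrite mul1r ler_eXn2l ?ltr1n// ltnW.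
apply: (le_trans hN).
have NR0 : 0 < N%:R :> R by rewrite ltr0n; lia.
have G0 : 0 < N%:R `^ beta by rewrite powR_gt0.
have eN : N%:R `^ (beta + p%:R^-1) = N%:R `^ beta * z.
  rewrite powRD ?(gt_eqF NR0) ?implybT//; congr (_ * _).
  have -> : N%:R = z `^ p%:R :> R.
    by rewrite powR_mulrn ?(ltW z0)// /N natrX /z -exprM mulnC.
  by rewrite -powRrM divff ?pnatr_eq0 -?lt0n// powRr1// ltW.
have hE : (energy x N)%:R <= `|Ke| * (N%:R `^ beta * z).
  rewrite -eN; apply: (le_trans (hKe N (ltnW N2))).
  by rewrite ler_wpM2r ?powR_ge0 ?ler_norm.
have S2 : (kap * l)%N%:R ^+ 2 <= z ^+ 2.
  by rewrite lerXn2r ?nnegrE ?(ltW z0)// /z -natrX ler_nat; exact: hl2.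
have K3 : 16 * `|Ke| <= z := hl3 l hll3.
move: ((size s)%:R) (ler0n R (size s)) (N%:R `^ beta) G0 hE => M M0 G G0 hE.
apply: (@le_trans _ _ (16 * (kap * l)%N%:R ^+ 2 * M * (`|Ke| * (G * z)))).
  by rewrite ler_wpM2l// !mulr_ge0 ?sqr_ge0.
have -> : 16 * (kap * l)%N%:R ^+ 2 * M * (`|Ke| * (G * z)) =
   (kap * l)%N%:R ^+ 2 * (16 * `|Ke|) * (M * G * z) by ring.
have -> : M * z ^+ 4 * G = z ^+ 2 * z * (M * G * z) by ring.
apply: ler_wpM2r; first by rewrite !mulr_ge0 ?(ltW G0) ?(ltW z0).
by apply: ler_pM => //; rewrite ?sqr_ge0 ?mulr_ge0.
Qed.

(** For [psi = z ^ 6 / M], the measure bound [z ^ 4 / (M * psi) = z ^ (-2)] is summable, while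
    [N ^ 4 <= M * z ^ 4 * N ^ beta] gives [psi <= z ^ 10 * N ^ (beta - 4)]. *)
Lemma exceptional_set (p : nat) (A : R) : (0 < p)%N -> 1 <= A ->
  exists (C : R) (l0 : nat), 0 <= C /\ forall l, (l0 <= l)%N -> exists E : set R,
  [/\ measurable E, (lebesgue_measure E <= (C / 2 ^+ l)%:E)%E &
   forall al, A^-1 <= `|al| <= A -> ~ E `|al| ->
     delta_min x al (2 ^ (p * l)) < 2 ^+ (10 * l) * ((2 ^ (p * l))%N%:R) `^ (- (4 - beta))].
Proof.
move=> p0 A1; have A0 : 0 < A by lra.
have [kap [l1 hl1]] := differences_at_level p p0.
(* Integer parts are at most [2Y], so [M <= 2 * z ^ kap + 1 <= z ^ (kap + 2)]. *)
pose q := (kap + 2)%N.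
pose b := (2 * (2 * q + 2) + 3)%N.
have b0 : (0 < b)%N by rewrite /b addn_gt0 orbT.
have [K K0 hK] := eta_partial_Lindelof b b0 LH.
have [l2 hl2] := mul_le_exp2 (16 * (2 * q + 2 + 2 * b + 3)).
have [l3 hl3] := exp2_ge (16 * A / c).
have [Cc CcE] : exists Cc : R, Cc = 2048 * (256 * 12) by exists (2048 * (256 * 12)).
have Cc0 : 0 <= Cc by rewrite CcE; exact: (mulr_ge0 (ler0n R 2048) (mulr_ge0 (ler0n R 256) (ler0n R 12))).
pose C := Cc * A ^+ 2 * K * (16 * A / c).
have C0 : 0 <= C by rewrite !mulr_ge0 ?sqr_ge0 ?invr_ge0 ?(ltW A0) ?(ltW K0) ?(ltW c0).
exists C, (maxn 2 (maxn l1 (maxn l2 l3))); split=> // l.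
rewrite !geq_max => /and4P[l_ge2 hll1 hll2 hll3].
set N := (2 ^ (p * l))%N; pose z : R := 2 ^+ l.
have [Y [s [d [us s0 /andP[cY Yz] hs hN]]]] := hl1 l hll1.
rewrite -/N -/z in Yz hs hN *.
have N1 : (1 <= N)%N by rewrite expn_gt0.
have NR0 : 0 < N%:R :> R by rewrite ltr0n.
have z4 : 4 <= z.
  have -> : 4 = 2 ^+ 2 :> R by ring.
  by rewrite /z ler_eXn2l ?ltr1n.
have z1 : 1 <= z by lra.
have z0 : 0 < z by lra.
pose M : R := (size s)%:R.
have M0 : 0 < M by rewrite ltr0n.
have Mz : M <= z ^+ q.
  apply: (@le_trans _ _ (2 * (2 ^ l) ^ kap + 1)%N%:R).
    rewrite ler_nat; apply: uniq_size_le => // k /hs[/andP[k1 _] /andP[_ k2] _].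
    rewrite addn1 ltnS -(ler_nat R) natrM !natrX -/z.
    by apply: (le_trans k1); apply: (le_trans k2); rewrite ler_pM2l.
  rewrite natrD natrM !natrX -/z /q exprD.
  have := exprn_ege1 kap z1; move: (z ^+ kap) => y y1.
  have : y * 4 <= y * z ^+ 2.
    rewrite ler_wpM2l//; first lra.
    by rewrite expr2; apply: (le_trans z4); rewrite ler_peMr// ltW.
  lra.
pose psi := z ^+ 6 / M.
have psi0 : 0 < psi by rewrite divr_gt0// exprn_gt0.
have target : psi <= z ^+ 10 * N%:R `^ (- (4 - beta)).
  rewrite opprB powRB ?(gt_eqF NR0) ?implybT// powR_mulrn ?ler0n//.
  have -> : z ^+ 10 * (N%:R `^ beta / N%:R ^+ 4) = z ^+ 6 * (z ^+ 4 * N%:R `^ beta / N%:R ^+ 4).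
    by field; rewrite gt_eqF.
  rewrite /psi ler_pM2l ?exprn_gt0// ler_pdivlMr ?exprn_gt0// mulrC ler_pdivrMr//.
  by rewrite [leRHS]mulrC mulrA.
(* For negative [al] the two indices are exchanged, so that only [|al|] matters. *)
have near (al : R) : (exists2 k, k \in s & exists n : nat, `| `|al| * d k - n%:R| < psi) ->
    delta_min x al N < 2 ^+ (10 * l) * N%:R `^ (- (4 - beta)).
  move=> [k /hs[_ _ [i [j [hi hj ij dE]]]] [n hn]].
  have -> : 2 ^+ (10 * l) = z ^+ 10 :> R by rewrite -exprM mulnC.
  apply: (lt_le_trans _ target); apply: (le_lt_trans _ hn); rewrite dE.
  have [al0|al0] := leP 0 al.
    apply: (le_trans (delta_min_le x al N j i hj hi _)); first by rewrite eq_sym.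
    by rewrite (ger0_norm al0) mulrBr (pmulrn 1 n); exact: dist_int_le.
  apply: (le_trans (delta_min_le x al N i j hi hj ij)).
  rewrite (ltr0_norm al0) (_ : - al * (x j - x i) = al * x i - al * x j); last by ring.
  by rewrite (pmulrn 1 n); exact: dist_int_le.
(* When [psi > 1] every real is within [psi] of an integer, and nothing is exceptional. *)
have [psi1|psi1] := leP psi 1; last first.
  exists set0; split => //; first by rewrite measure0 lee_fin divr_ge0 ?exprn_ge0.
  move=> al _ _; apply: near; case: (s) s0 hs => // k s' _ hs; exists k; first by rewrite mem_head.
  have dk : 0 <= d k.
    by have [/andP[h _] _ _] := hs k (mem_head _ _); apply: le_trans h.
  exists (Num.truncn (`|al| * d k)).
  have /andP[h1 h2] := truncn_itv (mulr_ge0 (normr_ge0 al) dk).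
  rewrite -natr1 in h2.
  by apply: (le_lt_trans _ psi1); rewrite ger0_norm ?subr_ge0//; lra.
have psiz : 1 <= psi * z ^+ q.
  rewrite /psi mulrAC ler_pdivlMr// mul1r; apply: (le_trans Mz).
  by rewrite ler_peMl ?exprn_ge0 ?(ltW z0)// exprn_ege1.
have hs' k : k \in s -> k%:R <= d k < k.+1%:R /\ Y <= d k <= 2 * Y by move=> /hs[].
have Yq : Y <= z ^+ q.
  by apply: (le_trans Yz); rewrite /q exprD ler_peMr ?exprn_ge0 ?(ltW z0)// exprn_ege1.
have [E [mE muE hE]] := bad_set_bound A c z Y psi q l A1 c0 c1 erefl (hl3 l hll3) cY Yq psi0 psi1
  psiz (hl2 l hll2) K s d (ltW K0) (fun t M' => hK z t M' z1) us s0 hs'.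
exists E; split => //.
- apply: (le_trans muE); rewrite -CcE -/C lee_fin -/M.
  have -> : M * psi = z ^+ 6 by rewrite /psi; field; rewrite gt_eqF.
  rewrite -mulrA ler_wpM2l// -/z.
  have -> : z ^+ 4 / z ^+ 6 = z^-1 * z^-1 by field; rewrite gt_eqF.
  by rewrite ler_piMr ?invr_ge0 ?invf_le1 ?(ltW z0).
- by move=> al hal nE; apply: near; exact: hE.
Qed.

Lemma almost_every_level (p : nat) (A : R) : (0 < p)%N -> 1 <= A ->
  {ae (@lebesgue_measure R), forall al : R, A^-1 <= `|al| <= A ->
    exists l0 : nat, forall l, (l0 <= l)%N ->
      delta_min x al (2 ^ (p * l)) < 2 ^+ (10 * l) * ((2 ^ (p * l))%N%:R) `^ (- (4 - beta))}.
Proof.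
move=> p0 A1; have [C [l0 [C0 hl]]] := exceptional_set p A p0 A1.
have [E hE] : {E : nat -> set R & forall l, (l0 <= l)%N ->
  [/\ measurable (E l), (lebesgue_measure (E l) <= (C / 2 ^+ l)%:E)%E &
   forall al, A^-1 <= `|al| <= A -> ~ E l `|al| ->
     delta_min x al (2 ^ (p * l)) < 2 ^+ (10 * l) * ((2 ^ (p * l))%N%:R) `^ (- (4 - beta))]}.
  apply: (@choice _ _ (fun l (E : set R) => (l0 <= l)%N ->
    [/\ measurable E, (lebesgue_measure E <= (C / 2 ^+ l)%:E)%E &
     forall al, A^-1 <= `|al| <= A -> ~ E `|al| ->
     delta_min x al (2 ^ (p * l)) < 2 ^+ (10 * l) * ((2 ^ (p * l))%N%:R) `^ (- (4 - beta))])) => l.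
  have [h|h] := boolP (l0 <= l)%N; last by exists set0.
  by have [E hE] := hl l h; exists E.
pose F l := if (l0 <= l)%N then E l else set0.
have mF l : measurable (F l) by rewrite /F; case: ifP => // h; have [] := hE l h.
have muF l : (lebesgue_measure (F l) <= (C / 2 ^+ l)%:E)%E.
  rewrite /F; case: ifP => h; first by have [] := hE l h.
  by rewrite measure0 lee_fin divr_ge0 ?exprn_ge0.
have Z0 := borel_cantelli_geometric F C mF muF.
pose Z := lim_sup_set F.
have mZ : measurable Z.
  by apply: bigcap_measurable => // k _; apply: bigcup_measurable => j _; exact: mF.
have [mZ' muZ'] := lebesgue_measure_opp Z mZ.
(* Membership of [|al|] in [Z] means that [al] lies in [Z] or in its reflection. *)
exists (Z `|` -%R @^-1` Z); split.
- exact: measurableU.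
- apply/eqP; rewrite eq_le measure_ge0 andbT.
  apply: (@le_trans _ _ (lebesgue_measure Z + lebesgue_measure (-%R @^-1` Z))%E).
    exact: measureU2.
  by rewrite muZ' [X in (X + _)%E]Z0 [X in (_ + X)%E]Z0 adde0.
move=> al; apply: contra_notP => hZ hal.
have nZ : ~ Z `|al|.
  have [al0|al0] := leP 0 al.
    by rewrite ger0_norm// => h; apply: hZ; left.
  by rewrite ltr0_norm// => h; apply: hZ; right.
have [n hn] : exists n, forall j, (n <= j)%N -> ~ F j `|al|.
  apply: contrapT => hno; apply: nZ => n _; apply: contrapT => hF; apply: hno.
  by exists n => j nj Fj; apply: hF; exists j.
exists (maxn l0 n) => l; rewrite geq_max => /andP[ll nl].
have [_ _ h] := hE l ll; apply: h => // El; apply: (hn l nl).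
by rewrite /F ll.
Qed.

End LevelSets.

Theorem theorem3 (x : nat -> Rdefinitions.R) (beta : Rdefinitions.R) :
  Lindelof_hypothesis Rdefinitions.R ->
  (forall n : nat, (1 <= n)%N -> 0 < x n) ->
  (exists c : Rdefinitions.R, 0 < c /\ forall n : nat, (1 <= n)%N -> c <= x n.+1 - x n) ->
  (exists C K : Rdefinitions.R, forall n : nat, (1 <= n)%N -> x n <= K * (n%:R) `^ C) ->
  (forall eps : Rdefinitions.R, 0 < eps -> exists K : Rdefinitions.R,
      forall N : nat, (1 <= N)%N -> (energy x N)%:R <= K * (N%:R) `^ (beta + eps)) ->
  {ae (@lebesgue_measure Rdefinitions.R), forall alpha : Rdefinitions.R,
    exists f : nat -> Rdefinitions.R, f @ \oo --> (0 : Rdefinitions.R) /\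
      exists N0 : nat, forall N : nat, (N0 <= N)%N ->
        delta_min x alpha N < (N%:R) `^ (- (4 - beta - f N))}.
Proof.
move=> LH x0 [c [c0 hc]] growth henergy.
pose c' := Num.min c 1.
have c'0 : 0 < c' by rewrite lt_min c0 ltr01.
have c'1 : c' <= 1 by rewrite ge_min lexx orbT.
have hc' n : (1 <= n)%N -> c' <= x n.+1 - x n.
  by move=> /hc; apply: le_trans; rewrite ge_min lexx.
have levels := almost_every_level x beta c' LH c'0 c'1 x0 hc' growth henergy.
(* The exponents [p = k.+1] and the annuli [1 / A.+1 <= |al| <= A.+1] are countably many, so a
   single null set serves them all. *)
have levels' (k : nat) : {ae (@lebesgue_measure Rdefinitions.R), forall al : Rdefinitions.R,
    forall A : nat, (A.+1%:R)^-1 <= `|al| <= A.+1%:R ->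
    exists l0 : nat, forall l, (l0 <= l)%N ->
      delta_min x al (2 ^ (k.+1 * l)) <
        2 ^+ (10 * l) * ((2 ^ (k.+1 * l))%N%:R) `^ (- (4 - beta))}.
  by apply: ae_foralln => A; apply: levels => //; rewrite ler1n.
have /ae_foralln := levels'.
apply: filterS => al hal.
apply: (exponent_correction (delta_min x al) (4 - beta)).
  by move=> N; exact: delta_min_ge0.
(* The point 0 lies in no annulus; there every distance is 0. *)
have [->|al0] := eqVneq al 0.
  move=> eps _; exists 2%N => N N2.
  have h : delta_min x 0 N <= 0.
    apply: (le_trans (delta_min_le x 0 N 1 2 _ _ _)) => //; first by rewrite /= ltnW.
    by rewrite !mul0r subrr; apply: (le_trans (dist_int_le 0 0)); rewrite subr0 normr0.
  by apply: (le_lt_trans h); rewrite powR_gt0// ltr0n; lia.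
apply: dyadic_to_all => [N N'|[//|p] _]; first exact: delta_min_mono.
pose A := maxn (Num.bound `|al|) (Num.bound `|al|^-1).
apply: (hal p A).
have a0 : 0 < `|al| by rewrite normr_gt0.
have bA : `|al| <= A.+1%:R.
  by apply: (le_trans (ltW (archi_boundP _))) => //; rewrite ler_nat leqW// leq_maxl.
have bA' : `|al|^-1 <= A.+1%:R.
  apply: (le_trans (ltW (archi_boundP _))); first by rewrite invr_ge0.
  by rewrite ler_nat leqW// leq_maxr.
by rewrite bA andbT -[leRHS]invrK lef_pV2 ?posrE ?invr_gt0 ?ltr0n.
Qed.
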